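(* For any $1\le r\le\infty$, $s\in\mathbb{R}$ and $T>0$, the flow map $S:\hat H^s_r(\mathbb{T})\times(-T,T)\to\hat H^s_r(\mathbb{T})$ of the Cauchy problem for the fourth-order dNLS hierarchy equation $$i\partial_tu-\partial_x^4u=\partial_x\Big(-iu^2\overline{u}_{xx}-4i|u|^2u_{xx}-2i|u_x|^2u-3iu_x^2\overline u-\tfrac{15}{2}|u|^4u_x+\tfrac{5i}{2}|u|^6u\Big)$$ with periodic initial data cannot be thrice continuously differentiable.
   Context: $\mathbb{T}=\mathbb{R}/2\pi\mathbb{Z}$; $\|u\|_{\hat H^s_r(\mathbb{T})}=\|\langle k\rangle^s\hat u(k)\|_{\ell^{r'}_k(\mathbb{Z})}$ with $r'$ the Hölder conjugate of $r$. *)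

(* Defs.v *)
From mathcomp Require Import all_boot all_order all_algebra.
From mathcomp Require Import all_classical all_reals all_analysis.
From mathcomp.real_closed Require Import complex.

Set Implicit Arguments.
Unset Strict Implicit.
Unset Printing Implicit Defensive.

Import Order.TTheory GRing.Theory Num.Theory.
Import numFieldNormedType.Exports.
Local Open Scope ring_scope.
Local Open Scope complex_scope.

(* Periodic (distributions) on T = R/2piZ are represented by their Fourier   *)
(* coefficients: u = sum_k a k e^{ikx}, a : int -> C.  Every element of      *)
(* hat H^s_r(T) is such a sequence.                                          *)

Section Defs.
Variable R : realType.
Local Notation C := R[i].

Definition seqC := int -> C.

Definition cabs (z : C) : R := Num.sqrt (complex.Re z ^+ 2 + complex.Im z ^+ 2).

Definition jbr (k : int) : R := Num.sqrt (1 + (k%:~R : R) ^+ 2).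

(* pointwise vector-space operations on coefficient sequences
   (real scalars: the flow map is only real-differentiable) *)
Definition addS (a b : seqC) : seqC := fun k => a k + b k.
Definition subS (a b : seqC) : seqC := fun k => a k - b k.
Definition scaleS (c : R) (a : seqC) : seqC := fun k => c%:C * a k.

(* || <k>^s a(k) ||_{l^{r'}_k}, r' the Hoelder conjugate of r, 1 <= r <= oo.
   r = 1   -> r' = oo : supremum;
   r = oo  -> r' = 1  : plain sum;
   1<r<oo  -> r' = r/(r-1). *)
Definition FLnorm (s : R) (r : \bar R) (a : seqC) : \bar R :=
  match r with
  | +oo%E => (\esum_(k in [set: int]) ((jbr k `^ s * cabs (a k))%:E))%E
  | r0%:E =>
      if r0 == 1 then ereal_sup (range (fun k => (jbr k `^ s * cabs (a k))%:E))
      else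
        let r' := r0 / (r0 - 1) in
        poweR (\esum_(k in [set: int]) (((jbr k `^ s * cabs (a k)) `^ r')%:E)) r'^-1
  | -oo%E => +oo%E
  end.

Definition FL (s : R) (r : \bar R) : set seqC := [set a | (FLnorm s r a < +oo)%E].

Definition FLn (s : R) (r : \bar R) (a : seqC) : R := fine (FLnorm s r a).

Section C3.
Variables (s : R) (r : \bar R).
Local Notation X := (FL s r).
Local Notation N := (FLn s r).
Local Notation NE := (FLnorm s r).

Definition rlinear (L : seqC -> seqC) : Prop :=
  forall a b, X a -> X b -> forall c : R, L (addS a (scaleS c b)) = addS (L a) (scaleS c (L b)).

Definition bounded_multilinear1 (L : seqC -> seqC) : Prop :=
  rlinear L /\ exists M : R, forall h, X h -> (NE (L h) <= (M * N h)%:E)%E.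

Definition bounded_multilinear2 (L : seqC -> seqC -> seqC) : Prop :=
  (forall v, X v -> rlinear (L^~ v)) /\ (forall h, X h -> rlinear (L h)) /\
  exists M : R, forall h v, X h -> X v -> (NE (L h v) <= (M * N h * N v)%:E)%E.

Definition bounded_multilinear3 (L : seqC -> seqC -> seqC -> seqC) : Prop :=
  (forall v w, X v -> X w -> rlinear (fun h => L h v w)) /\
  (forall h w, X h -> X w -> rlinear (fun v => L h v w)) /\
  (forall h v, X h -> X v -> rlinear (L h v)) /\
  exists M : R, forall h v w, X h -> X v -> X w ->
    (NE (L h v w) <= (M * N h * N v * N w)%:E)%E.

(* F is C^3 on X = hat H^s_r, with successive Frechet derivatives
   D1, D2, D3 (taking values in bounded multilinear maps, with the
   operator norms), and D3 continuous. *)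
Definition C3_on (F : seqC -> seqC) : Prop :=
  (forall a, X a -> X (F a)) /\
  exists (D1 : seqC -> seqC -> seqC) (D2 : seqC -> seqC -> seqC -> seqC)
         (D3 : seqC -> seqC -> seqC -> seqC -> seqC),
  forall x, X x ->
    [/\ [/\ bounded_multilinear1 (D1 x),
            bounded_multilinear2 (D2 x) &
            bounded_multilinear3 (D3 x)],
        (forall eps : R, 0 < eps -> exists del : R, 0 < del /\
           forall h, X h -> N h < del ->
             (NE (subS (subS (F (addS x h)) (F x)) (D1 x h)) <= (eps * N h)%:E)%E),
        (forall eps : R, 0 < eps -> exists del : R, 0 < del /\
           forall h, X h -> N h < del -> forall v, X v ->
             (NE (subS (subS (D1 (addS x h) v) (D1 x v)) (D2 x h v))
                <= (eps * N h * N v)%:E)%E),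
        (forall eps : R, 0 < eps -> exists del : R, 0 < del /\
           forall h, X h -> N h < del -> forall v w, X v -> X w ->
             (NE (subS (subS (D2 (addS x h) v w) (D2 x v w)) (D3 x h v w))
                <= (eps * N h * N v * N w)%:E)%E) &
        (forall eps : R, 0 < eps -> exists del : R, 0 < del /\
           forall h, X h -> N h < del -> forall u v w, X u -> X v -> X w ->
             (NE (subS (D3 (addS x h) u v w) (D3 x u v w))
                <= (eps * N u * N v * N w)%:E)%E)].
End C3.

(* sum over Z of a (absolutely summable) sequence: limit of symmetric partial sums *)
Definition partialZ (f : int -> R) (N : nat) : R :=
  \sum_(j < (N + N).+1) f (j%:Z - N%:Z).
Definition sumZ (f : int -> C) : C :=
  (limn (partialZ (fun j => complex.Re (f j))))
    +i* (limn (partialZ (fun j => complex.Im (f j)))).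

Definition dx (a : seqC) : seqC := fun k => 'i * (k%:~R : R)%:C * a k.
(* complex conjugation of the function: \bar u has coefficients conj(a(-k)) *)
Definition cj (a : seqC) : seqC := fun k => conjc (a (- k)).
(* product of functions = convolution of coefficients *)
Definition mulS (a b : seqC) : seqC := fun k => sumZ (fun j => a j * b (k - j)).
Definition cst (c : C) (a : seqC) : seqC := fun k => c * a k.

Definition nonlin (u : seqC) : seqC :=
  let ub := cj u in
  let ux := dx u in
  let uxx := dx ux in
  let ubx := cj ux in
  let ubxx := cj uxx in
  let i := ('i : C) in
  addS (cst (- i) (mulS (mulS u u) ubxx))
 (addS (cst (- (4%:R * i)) (mulS (mulS u ub) uxx))
 (addS (cst (- (2%:R * i)) (mulS (mulS ux ubx) u))
 (addS (cst (- (3%:R * i)) (mulS (mulS ux ux) ub))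
 (addS (cst (- (15%:R / 2%:R)) (mulS (mulS (mulS u ub) (mulS u ub)) ux))
       (cst (5%:R * i / 2%:R) (mulS (mulS (mulS u ub) (mulS (mulS u ub) (mulS u ub))) u)))))).

Definition cderiv (g : R -> C) (t : R) (D : C) : Prop :=
  is_derive t 1 (fun x => complex.Re (g x)) (complex.Re D) /\
  is_derive t 1 (fun x => complex.Im (g x)) (complex.Im D).

(* smooth functions on T  <->  rapidly decreasing Fourier coefficients *)
Definition smooth_data (a : seqC) : Prop :=
  forall m : nat, exists M : R, forall k, jbr k ^+ m * cabs (a k) <= M.

(* u : (-T,T) -> C^oo(T) is a smooth (classical) solution of
     i u_t - u_xxxx = d_x (nonlin u)
   on (-T,T): u is continuous in time with values in C^oo(T) (i.e. in every
   weighted norm sup_k <k>^m |a k|), each Fourier coefficient is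
   differentiable in t, and the equation holds coefficientwise. *)
Definition smooth_solution (T : R) (u : R -> seqC) : Prop :=
  (forall t, -T < t < T -> smooth_data (u t)) /\
  (forall (m : nat) t0, -T < t0 < T -> forall eps : R, 0 < eps ->
     exists del : R, 0 < del /\ forall t, -T < t < T -> `|t - t0| < del ->
       forall k, jbr k ^+ m * cabs (u t k - u t0 k) <= eps) /\
  (forall t, -T < t < T -> forall k, exists D : C,
     cderiv (fun x => u x k) t D /\
     'i * D - dx (dx (dx (dx (u t)))) k = dx (nonlin (u t)) k).

Definition flow_map (T : R) (S : seqC -> R -> seqC) : Prop :=
  forall u0, smooth_data u0 -> smooth_solution T (S u0) /\ S u0 0 = u0.

End Defs.

(* Main.v *)
(* Write D = -i d/dx and v for the conjugate of u; the equation becomes i u_t = D^4 u - D P(u,v) with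
   a real polynomial P.  It is integrable, and the functionals int uv and
   int (- Du Dv + 3/4 uv (u Dv - v Du) + 1/2 (uv)^3) are conserved along smooth solutions.
   Start from eps (1 + b e^{iNx}) with b = <N>^{-s}.  Conservation of the second functional and a
   continuity argument bound the H^1 norm by O(eps), uniformly in time; since the amplitudes of the
   modes 0 and N can only change by O(eps^3), the same conservation law leaves O(eps^2) in H^1 for
   all other modes together.  Integration by parts makes the cubic term an H^1-bounded trilinear
   form, so its N-th coefficient is, up to O(eps^4), the resonant self-interaction of those two
   modes, and Duhamel's formula gives
     e^{itN^4} u_N(t) = eps b + i t N^3 (4 + 6 b^2) b eps^3 + O(eps^4).
   If the flow at time t were C^3 on hat H^s_r, the eps^3 coefficient, weighted by <N>^s, would be
   bounded independently of N, whereas it grows like t N^3. *)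
Require Import Defs.
From HB Require Import structures.
From mathcomp Require Import all_boot all_order all_algebra.
From mathcomp Require Import all_classical all_reals all_analysis.
From mathcomp.real_closed Require Import complex.
From mathcomp Require Import ring lra zify.
Set Implicit Arguments.
Unset Strict Implicit.
Unset Printing Implicit Defensive.
Import Order.TTheory GRing.Theory Num.Theory.
Import numFieldNormedType.Exports.
Local Open Scope ring_scope.
Local Open Scope complex_scope.

(** * Conservation laws as differential-polynomial identities *)

(** The hypotheses supply smooth solutions but no bound on them and no link between the derivatives
    of the flow and Picard iterates. The cubic term loses derivatives, so Gronwall's inequality
    gives no control either; the conserved energy takes its place and bounds the solution on the
    whole time interval. The order of limits is essential: eps tends to 0 with N, b and t fixed, so
    every error constant may depend on N in any way, and only the extracted coefficient of eps^3 is
    examined for large N. The constant mode is what makes the argument work for every s. Since <N>^s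
    b = 1, the self-interaction of mode N contributes, after weighting, 6 N^3 b^2 t, which stays
    bounded for s >= 3/2; its interaction with the constant mode contributes 4 N^3 t whatever s is.
    The data have two modes of equal weighted size, so that r enters only through two elementary
    inequalities for the norm. *)

Section DifferentialRing.
Variables (A : comNzRingType) (d : A -> A).
Hypothesis dD : forall x y, d (x + y) = d x + d y.
Hypothesis dM : forall x y, d (x * y) = d x * y + x * d y.

Lemma der0 : d 0 = 0.
Proof. by apply: (addrI (d 0)); rewrite -dD !addr0. Qed.

Lemma derN x : d (- x) = - d x.
Proof. by apply: (addrI (d x)); rewrite -dD !subrr der0. Qed.

Lemma der_nat n x : d (n%:R * x) = n%:R * d x.
Proof.
elim: n => [|n IH]; first by rewrite !mul0r der0.
by rewrite -!natr1 !mulrDl !mul1r dD IH.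
Qed.

Lemma derX n x : d (x ^+ n.+2) = n.+2%:R * x ^+ n.+1 * d x.
Proof.
elim: n => [|n IH]; first by rewrite expr2 dM expr1; ring.
rewrite exprS dM IH -[n.+3%:R]natr1 (exprS _ n.+1); ring.
Qed.

Definition der_expand := (@expr1 A, dD, derN, der_nat, dM, derX).

(* For v the conjugate of u, these are 2 i u_t and 2 i v_t; the factor 2 clears the denominators of
   the nonlinearity. *)
Definition flow2 (u v : A) :=
  2%:R * d (d (d (d u))) - d (2%:R * u ^+ 2 * d (d v) + 8%:R * u * v * d (d u)
   + 4%:R * u * d u * d v + 6%:R * d u ^+ 2 * v - 15%:R * u ^+ 2 * v ^+ 2 * d u
   + 5%:R * u ^+ 4 * v ^+ 3).
Definition flow2b (u v : A) :=
  - (2%:R * d (d (d (d v)))) - d (2%:R * v ^+ 2 * d (d u) + 8%:R * u * v * d (d v)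
   + 4%:R * v * d v * d u + 6%:R * d v ^+ 2 * u + 15%:R * v ^+ 2 * u ^+ 2 * d v
   + 5%:R * v ^+ 4 * u ^+ 3).

(** Along the flow [X * v + u * Y] is 2i times the time derivative of uv; an exact derivative has
    mean zero. The factor 4 clears the denominator of the flux term 35/4 u^4 v^4. *)
Lemma mass_flux (u v : A) : let X := flow2 u v in let Y := flow2b u v in
  exists f, 4%:R * (X * v + u * Y) = d f.
Proof.
move=> X Y; rewrite {}/X {}/Y /flow2 /flow2b.
set u1 := d u; set u2 := d u1; set u3 := d u2.
set v1 := d v; set v2 := d v1; set v3 := d v2.
exists (- (8%:R * u * v3) + 8%:R * u1 * v2 - 8%:R * u2 * v1 + 8%:R * u3 * v - 40%:R * u ^+ 2 * v * v2 - 20%:R * u ^+ 2 * v1 ^+ 2 - 40%:R * u * u2 * v ^+ 2 - 20%:R * u1 ^+ 2 * v ^+ 2 - 60%:R * u ^+ 3 * v ^+ 2 * v1 + 60%:R * u ^+ 2 * u1 * v ^+ 3 - 35%:R * u ^+ 4 * v ^+ 4).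
rewrite !der_expand -/u1 -/v1 -/u2 -/v2 -/u3 -/v3. 
ring.
Qed.
(* The coefficients 3/4 and 1/2 of the conserved density (here multiplied by 4) and the flux come
   from solving a linear system. *)
Lemma energy_flux (u v : A) : let X := flow2 u v in let Y := flow2b u v in
  exists f, - (4%:R * (d X * d v + d u * d Y))
    + 3%:R * ((X * v + u * Y) * (u * d v - v * d u) + u * v * (X * d v + u * d Y - Y * d u - v * d X))
    + 6%:R * (u * v) ^+ 2 * (X * v + u * Y) = d f.
Proof.
move=> X Y; rewrite {}/X {}/Y /flow2 /flow2b.
set u1 := d u; set u2 := d u1; set u3 := d u2; set u4 := d u3.
set v1 := d v; set v2 := d v1; set v3 := d v2; set v4 := d v3.
exists (8%:R * u1 * v4 - 8%:R * u2 * v3 + 8%:R * u3 * v2 - 8%:R * u4 * v1 - 6%:R * u ^+ 2 * v * v4 + 8%:R * u ^+ 2 * v1 * v3 - 4%:R * u ^+ 2 * v2 ^+ 2 + 56%:R * u * u1 * v * v3 + 88%:R * u * u1 * v1 * v2 - 56%:R * u * u2 * v * v2 + 24%:R * u * u2 * v1 ^+ 2 + 24%:R * u1 ^+ 2 * v * v2 + 84%:R * u1 ^+ 2 * v1 ^+ 2 + 56%:R * u * u3 * v * v1 + 88%:R * u1 * u2 * v * v1 - 6%:R * u * u4 * v ^+ 2 + 8%:R * u1 * u3 * v ^+ 2 - 4%:R * u2 ^+ 2 * v ^+ 2 - 30%:R * u ^+ 3 * v ^+ 2 * v3 - 60%:R * u ^+ 3 * v * v1 * v2 + 180%:R * u ^+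 2 * u1 * v ^+ 2 * v2 - 30%:R * u ^+ 2 * u1 * v * v1 ^+ 2 - 180%:R * u ^+ 2 * u2 * v ^+ 2 * v1 + 30%:R * u * u1 ^+ 2 * v ^+ 2 * v1 + 30%:R * u ^+ 2 * u3 * v ^+ 3 + 60%:R * u * u1 * u2 * v ^+ 3 - 105%:R * u ^+ 4 * v ^+ 3 * v2 - 30%:R * u ^+ 4 * v ^+ 2 * v1 ^+ 2 + 200%:R * u ^+ 3 * u1 * v ^+ 3 * v1 - 105%:R * u ^+ 3 * u2 * v ^+ 4 - 30%:R * u ^+ 2 * u1 ^+ 2 * v ^+ 4 - 105%:R * u ^+ 5 * v ^+ 4 * v1 + 105%:R * u ^+ 4 * u1 * v ^+ 5 - 35%:R * u ^+ 6 * v ^+ 6).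
rewrite !der_expand -/u1 -/v1 -/u2 -/v2 -/u3 -/v3 -/u4 -/v4. 
ring.
Qed.
(* Integrating by parts leaves at most one derivative on each factor, and at most two overall,
   so that the cubic term is controlled by H^1 norms. *)
Lemma cubic_by_parts (u v : A) :
  2%:R * u ^+ 2 * d (d v) + 8%:R * u * v * d (d u) + 4%:R * u * d u * d v + 6%:R * d u ^+ 2 * v =
  d (2%:R * (u * (u * d v)) + 8%:R * (u * (v * d u)))
  - (8%:R * (u * (d u * d v)) + 2%:R * (v * (d u * d u))).
Proof. rewrite dD !der_nat !dM; ring. Qed.

(** Pairs the terms of two integrated cubic forms, so that each difference can be telescoped
    separately. *)
Lemma cubic_regroup (f g h l f' g' h' l' : A) :
  d (2%:R * f + 8%:R * g) - (8%:R * h + 2%:R * l) - (d (2%:R * f' + 8%:R * g') - (8%:R * h' + 2%:R * l'))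
  = d (2%:R * (f - f') + 8%:R * (g - g')) - (8%:R * (h - h') + 2%:R * (l - l')).
Proof. rewrite !dD !der_nat !dD !derN; ring. Qed.

End DifferentialRing.

(** * Unordered sums over the integers *)

Section AbsoluteValue.
Variable R : realType.
Local Notation C := R[i].
Implicit Types (x y z : C) (k : int).

Lemma cabsE z : cabs z = Normc.normc z.
Proof. by case: z. Qed.

Lemma cabs0 : cabs (0 : C) = 0.
Proof. by rewrite cabsE Normc.normc0. Qed.

Lemma cabs1 : cabs (1 : C) = 1.
Proof. by rewrite cabsE Normc.normc1. Qed.

Lemma cabsM x y : cabs (x * y) = cabs x * cabs y.
Proof. by rewrite !cabsE Normc.normcM. Qed.

Lemma cabsD x y : cabs (x + y) <= cabs x + cabs y.
Proof. by rewrite !cabsE le_normcD. Qed.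

Lemma cabsN x : cabs (- x) = cabs x.
Proof. by rewrite !cabsE normcN. Qed.

Lemma cabsB x y : cabs (x - y) <= cabs x + cabs y.
Proof. by rewrite -(cabsN y) cabsD. Qed.

Lemma cabs_distC x y : cabs (x - y) = cabs (y - x).
Proof. by rewrite -cabsN opprB. Qed.

Lemma cabs_ge0 z : 0 <= cabs z.
Proof. exact: sqrtr_ge0. Qed.

Lemma cabsR (a : R) : cabs a%:C = `|a|.
Proof. by rewrite /cabs /= expr0n addr0 sqrtr_sqr. Qed.

Lemma imaginaryE : @Num.imaginary R[i] = 'i%C.
Proof. by []. Qed.

Lemma cabsi : cabs ('i%C : C) = 1.
Proof. by rewrite /cabs /= expr0n add0r expr1n sqrtr1. Qed.

Lemma cabsJ z : cabs (conjc z) = cabs z.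
Proof. by case: z => a b; rewrite /cabs /= sqrrN. Qed.

Lemma cabs_eq0 z : cabs z = 0 -> z = 0.
Proof. by rewrite cabsE => /Normc.eq0_normc. Qed.

Lemma cabs2 z : cabs z ^+ 2 = complex.Re z ^+ 2 + complex.Im z ^+ 2.
Proof. by rewrite sqr_sqrtr// addr_ge0 ?sqr_ge0. Qed.

Lemma mulcJ z : z * conjc z = (cabs z ^+ 2)%:C.
Proof.
rewrite cabs2; case: z => a b /=; simpc.
by rewrite -!expr2 [b * a]mulrC addNr.
Qed.

Lemma Re_cabs z : `|complex.Re z| <= cabs z.
Proof.
by rewrite -sqrtr_sqr ler_sqrt ?lerDl ?sqr_ge0 ?addr_ge0 ?sqr_ge0.
Qed.

Lemma Im_cabs z : `|complex.Im z| <= cabs z.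
Proof.
by rewrite -sqrtr_sqr ler_sqrt ?lerDr ?sqr_ge0 ?addr_ge0 ?sqr_ge0.
Qed.

Lemma cabs_le z : cabs z <= `|complex.Re z| + `|complex.Im z|.
Proof.
rewrite -(@ler_pXn2r _ 2) ?nnegrE ?cabs_ge0 ?addr_ge0//.
rewrite cabs2 -(real_normK (num_real (complex.Re z))) -(real_normK (num_real (complex.Im z))).
have := normr_ge0 (complex.Re z); have := normr_ge0 (complex.Im z); nra.
Qed.

Lemma cabs_sum (I : Type) (r : seq I) (P : pred I) (F : I -> C) :
  cabs (\sum_(i <- r | P i) F i) <= \sum_(i <- r | P i) cabs (F i).
Proof.
elim/big_rec2: _ => [|i x y _ H]; first by rewrite cabs0.
by apply: le_trans (cabsD _ _) _; rewrite lerD2l.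
Qed.

Lemma ReD x y : complex.Re (x + y) = complex.Re x + complex.Re y.
Proof. by case: x; case: y. Qed.
Lemma ImD x y : complex.Im (x + y) = complex.Im x + complex.Im y.
Proof. by case: x; case: y. Qed.
Lemma cReM x y : complex.Re (x * y) =
  complex.Re x * complex.Re y - complex.Im x * complex.Im y.
Proof. by case: x; case: y. Qed.
Lemma cImM x y : complex.Im (x * y) =
  complex.Re x * complex.Im y + complex.Im x * complex.Re y.
Proof. by case: x; case: y. Qed.
Lemma ReN x : complex.Re (- x) = - complex.Re x. Proof. by case: x. Qed.
Lemma ImN x : complex.Im (- x) = - complex.Im x. Proof. by case: x. Qed.
Lemma complex_eq x y : complex.Re x = complex.Re y -> complex.Im x = complex.Im y -> x = y.
Proof. by case: x => a b; case: y => c d /= -> ->. Qed.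

Lemma conjM x y : conjc (x * y) = conjc x * conjc y. Proof. exact: rmorphM. Qed.
Lemma conjD x y : conjc (x + y) = conjc x + conjc y. Proof. exact: rmorphD. Qed.
Lemma conjN x : conjc (- x) = - conjc x. Proof. exact: rmorphN. Qed.
Lemma RCM (a b : R) : (a * b)%:C = a%:C * b%:C. Proof. exact: rmorphM. Qed.
Lemma RCD (a b : R) : (a + b)%:C = a%:C + b%:C. Proof. exact: rmorphD. Qed.
Lemma RCN (a : R) : (- a)%:C = - a%:C. Proof. exact: rmorphN. Qed.
Lemma RCX (a : R) n : (a ^+ n)%:C = a%:C ^+ n. Proof. exact: rmorphXn. Qed.
Lemma RC_nat n : (n%:R : R)%:C = n%:R. Proof. exact: rmorph_nat. Qed.
Lemma conji : conjc ('i%C : C) = - 'i%C. Proof. by apply: complex_eq; rewrite //= oppr0. Qed.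

Lemma jbr2 k : jbr R k ^+ 2 = 1 + (k%:~R) ^+ 2.
Proof. by rewrite sqr_sqrtr// addr_ge0 ?sqr_ge0. Qed.

Lemma jbr_ge1 k : 1 <= jbr R k.
Proof. by rewrite -[leLHS]sqrtr1 ler_sqrt ?lerDl ?sqr_ge0// addr_ge0 ?sqr_ge0. Qed.

Lemma jbr_gt0 k : 0 < jbr R k.
Proof. exact: lt_le_trans ltr01 (jbr_ge1 k). Qed.

Lemma jbr_ge0 k : 0 <= jbr R k.
Proof. exact: ltW (jbr_gt0 k). Qed.

Lemma jbrN k : jbr R (- k) = jbr R k.
Proof. by rewrite /jbr rmorphN sqrrN. Qed.

Lemma jbr0 : jbr R 0 = 1.
Proof. by rewrite /jbr rmorph0 expr0n addr0 sqrtr1. Qed.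

Lemma jbr_abs k : `|k%:~R| <= jbr R k.
Proof. by rewrite -sqrtr_sqr ler_sqrt ?lerDr// addr_ge0 ?sqr_ge0. Qed.

Lemma jbrD j k : jbr R (j + k) <= 2 * jbr R j * jbr R k.
Proof.
rewrite -(@ler_pXn2r _ 2) ?nnegrE ?mulr_ge0 ?jbr_ge0// !exprMn !jbr2 rmorphD /=.
move: (j%:~R : R) (k%:~R : R) => x y.
have := sqr_ge0 (x - y); have := sqr_ge0 (x * y); nra.
Qed.

Lemma jbr_expn_ge1 k m : 1 <= jbr R k ^+ m.
Proof. by rewrite exprn_ege1// jbr_ge1. Qed.

End AbsoluteValue.

Section SymmetricSums.
Variable R : realType.
Local Notation C := R[i].
Implicit Types (f g : int -> C) (u v : int -> R).

(** Convertible to [partialZ] over the reals; the polymorphic form serves complex terms and real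
    majorants alike. *)
Definition psum (V : zmodType) (f : int -> V) (n : nat) : V :=
  \sum_(j < (n + n).+1) f (j%:Z - n%:Z).

Lemma psum0 (V : zmodType) (f : int -> V) : psum f 0 = f 0.
Proof. by rewrite /psum big_ord1. Qed.

Lemma psumS (V : zmodType) (f : int -> V) n :
  psum f n.+1 = psum f n + f n.+1%:Z + f (- n.+1%:Z).
Proof.
rewrite /psum addSn addnS big_ord_recl big_ord_recr /= sub0r [LHS]addrC.
congr (_ + _ + _).
  apply: eq_bigr => i _; congr f.
  by rewrite /bump /= add1n -(addn1 n) -(addn1 i) !PoszD; ring.
by congr f; rewrite /bump /= add1n; lia.
Qed.

Lemma psumD (V : zmodType) (f g : int -> V) n :
  psum (fun j => f j + g j) n = psum f n + psum g n.
Proof. exact: big_split. Qed.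

Lemma psumZ (V : pzRingType) (c : V) (f : int -> V) n :
  psum (fun j => c * f j) n = c * psum f n.
Proof. by rewrite /psum mulr_sumr. Qed.

Lemma psum_opp (V : zmodType) (f : int -> V) n :
  psum (fun j => f (- j)) n = psum f n.
Proof.
elim: n => [|n IH]; first by rewrite !psum0 oppr0.
by rewrite !psumS IH opprK addrAC.
Qed.

Lemma psum_shift (V : zmodType) (f : int -> V) n :
  psum (fun j => f (j + 1)) n = psum f n + f (n.+1%:Z) - f (- n%:Z).
Proof.
elim: n => [|n IH]; first by rewrite !psum0 add0r oppr0 addrAC subrr add0r.
rewrite !psumS IH.
have -> : - n.+1%:Z + 1 = - n%:Z by lia.
have -> : n.+1%:Z + 1 = n.+2%:Z by lia.
by rewrite [_ - _ + _]addrAC subrK -[_ + f (- n.+1%:Z) + _]addrA [f (- _) + f _]addrC addrA addrK.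
Qed.

Lemma Re_psum f n : complex.Re (psum f n) = psum (fun j => complex.Re (f j)) n.
Proof. by rewrite /psum; elim/big_rec2: _ => // i x y _ <-; rewrite ReD. Qed.

Lemma Im_psum f n : complex.Im (psum f n) = psum (fun j => complex.Im (f j)) n.
Proof. by rewrite /psum; elim/big_rec2: _ => // i x y _ <-; rewrite ImD. Qed.

Lemma psum_cabs f n : cabs (psum f n) <= psum (fun j => cabs (f j)) n.
Proof. exact: cabs_sum. Qed.

Lemma psum_le u v n : (forall j, u j <= v j) -> psum u n <= psum v n.
Proof. by move=> H; apply: ler_sum => i _. Qed.

Lemma psum_ge0 u n : (forall j, 0 <= u j) -> 0 <= psum u n.
Proof. by move=> H; apply: sumr_ge0 => i _. Qed.

Lemma psum_mono u n m : (forall j, 0 <= u j) -> (n <= m)%N -> psum u n <= psum u m.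
Proof.
move=> H; elim: m => [|m IH]; first by rewrite leqn0 => /eqP ->.
rewrite leq_eqVlt => /orP [/eqP -> //|]; rewrite ltnS => /IH h.
by rewrite psumS -addrA; apply: le_trans h _; rewrite lerDl addr_ge0.
Qed.

Lemma psum_term u k : (forall j, 0 <= u j) -> u k <= psum u `|k|%N.
Proof.
move=> H; case: k => [[|n]|n]; first by rewrite psum0.
- by rewrite psumS addrAC lerDr addr_ge0// psum_ge0.
- by rewrite NegzE abszN /= psumS lerDr addr_ge0// psum_ge0.
Qed.

(** The window of radius n moved by k lies in the centred window of radius n + |k|. Negative shifts
    reduce to positive ones by reflection. *)
Lemma psum_translate u n k : (forall j, 0 <= u j) ->
  psum (fun j => u (j + k)) n <= psum u (n + `|k|)%N.
Proof.
have pos (m p : nat) v : (forall j, 0 <= v j) ->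
    psum (fun j => v (j + m%:Z)) p <= psum v (p + m)%N.
  elim: m p v => [|m IH] p v H.
    by rewrite addn0; apply: psum_le => j; rewrite addr0.
  rewrite -addSnnS; apply: le_trans (IH p.+1 v H).
  set w := fun j => v (j + m%:Z).
  rewrite (_ : psum _ _ = psum (fun j => w (j + 1)) p).
    rewrite psum_shift psumS.
    have := H (- p%:Z + m%:Z); have := H (- p.+1%:Z + m%:Z); rewrite -/(w _) -/(w _); lra.
  by congr psum; apply/funext => j; congr v; lia.
move=> H; case: (ltP k 0) => hk.
  rewrite -psum_opp -(psum_opp u).
  apply: le_trans (pos `|k|%N n (fun j => u (- j)) _) => //.
  by apply: psum_le => j; rewrite (_ : - j + k = - (j + `|k|%N%:Z))//; lia.
by apply: le_trans (pos `|k|%N n u _) => //; apply: psum_le => j; rewrite (_ : j + k = j + `|k|%N%:Z)//; lia.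
Qed.

End SymmetricSums.

Section UnorderedSums.
Variable R : realType.
Local Notation C := R[i].
Implicit Types (f g : int -> C) (u v : int -> R) (l : C).

(** [sumZ] is built on [limn], which says nothing in the absence of convergence; this predicate
    carries the convergence together with the limit. *)
Definition hsum f l := forall e : R, 0 < e ->
  exists n0, forall n, (n0 <= n)%N -> cabs (psum f n - l) <= e.

Definition absum f (M : R) := forall n, psum (fun j => cabs (f j)) n <= M.

Lemma cvgn_eps (x : nat -> R) a : (x @ \oo --> a)%classic <->
  (forall e, 0 < e -> exists n0, forall n, (n0 <= n)%N -> `|x n - a| <= e).
Proof.
split=> [/cvgrPdist_le H e /H [n0 _ h]|H].
  by exists n0 => n hn; rewrite distrC h.
apply/cvgrPdist_le => e /H [n0 h]; exists n0 => // n /= hn.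
by rewrite distrC h.
Qed.

Lemma hsum_sumZ f l : hsum f l -> sumZ f = l.
Proof.
move=> H; apply: complex_eq => /=.
- apply: cvg_lim => //; apply/cvgn_eps => e /H [n0 h]; exists n0 => n /h.
  by apply: le_trans; rewrite -[partialZ _ _]/(psum _ _) -Re_psum -ReN -ReD Re_cabs.
- apply: cvg_lim => //; apply/cvgn_eps => e /H [n0 h]; exists n0 => n /h.
  by apply: le_trans; rewrite -[partialZ _ _]/(psum _ _) -Im_psum -ImN -ImD Im_cabs.
Qed.

(** [u] is the difference of the nonnegative families [u + v] and [v], whose partial sums are
    nondecreasing and bounded. *)
Lemma psum_cvg u v M : (forall j, `|u j| <= v j) -> (forall n, psum v n <= M) ->
  cvgn (psum u).
Proof.
move=> uv vM.
have v0 j : 0 <= v j by apply: le_trans (uv j).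
have uv0 j : 0 <= u j + v j by have := uv j; rewrite ler_norml => /andP[]; lra.
have mono (w : int -> R) (K : R) : (forall j, 0 <= w j) -> (forall n, psum w n <= K) -> cvgn (psum w).
  move=> w0 wK; apply: nondecreasing_is_cvgn.
    by move=> m n; exact: psum_mono.
  by exists K => _ [n _ <-].
rewrite (_ : psum u = psum (fun j => u j + v j) - psum v).
  apply: is_cvgB; last exact: mono vM.
  apply: (mono _ (M + M)) => // n; rewrite psumD lerD//.
  apply: le_trans (vM n); apply: psum_le => j; apply: le_trans (uv j); exact: ler_norm.
apply/funext => n; rewrite -[RHS]/(psum _ n - psum v n) psumD; lra.
Qed.

Lemma absum_hsum f M : absum f M -> hsum f (sumZ f).
Proof.
move=> fM e e0.
have hr : (psum (fun j => complex.Re (f j)) @ \oo --> complex.Re (sumZ f))%classic.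
  by apply: psum_cvg fM => j; exact: Re_cabs.
have hi : (psum (fun j => complex.Im (f j)) @ \oo --> complex.Im (sumZ f))%classic.
  by apply: psum_cvg fM => j; exact: Im_cabs.
have e2 : 0 < e / 2 by rewrite divr_gt0.
have [n1 h1] := (cvgn_eps _ _).1 hr _ e2.
have [n2 h2] := (cvgn_eps _ _).1 hi _ e2.
exists (maxn n1 n2) => n; rewrite geq_max => /andP[/h1 H1 /h2 H2].
apply: le_trans (cabs_le _) _; rewrite ReD ImD ReN ImN Re_psum Im_psum.
lra.
Qed.

Lemma hsumD f g l l' : hsum f l -> hsum g l' -> hsum (fun j => f j + g j) (l + l').
Proof.
move=> hf hg e e0; have e2 : 0 < e / 2 by rewrite divr_gt0.
have [n1 h1] := hf _ e2; have [n2 h2] := hg _ e2.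
exists (maxn n1 n2) => n; rewrite geq_max => /andP[/h1 H1 /h2 H2].
rewrite psumD (_ : _ - _ = (psum f n - l) + (psum g n - l')); last ring.
apply: le_trans (cabsD _ _) _; lra.
Qed.

Lemma hsumZ c f l : hsum f l -> hsum (fun j => c * f j) (c * l).
Proof.
move=> hf e e0; have c0 := cabs_ge0 c.
have d0 : 0 < e / (cabs c + 1) by rewrite divr_gt0// ltr_wpDl.
have [n1 h1] := hf _ d0; exists n1 => n /h1 H.
rewrite psumZ -mulrBr cabsM; apply: le_trans (ler_wpM2l c0 H) _.
rewrite mulrA ler_pdivrMr ?ltr_wpDl// mulrC ler_pM2l//; lra.
Qed.

Lemma hsumN f l : hsum f l -> hsum (fun j => - f j) (- l).
Proof.
move=> /(hsumZ (-1)); rewrite mulN1r; congr hsum.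
by apply/funext => j; rewrite mulN1r.
Qed.

Lemma hsumB f g l l' : hsum f l -> hsum g l' -> hsum (fun j => f j - g j) (l - l').
Proof. by move=> hf /hsumN; exact: hsumD. Qed.

Lemma hsum_opp f l : hsum f l -> hsum (fun j => f (- j)) l.
Proof. by move=> hf e /hf [n h]; exists n => m /h; rewrite psum_opp. Qed.

Lemma hsum0 : hsum (fun=> 0) 0.
Proof. by move=> e e0; exists 0%N => n _; rewrite /psum big1// subrr cabs0 ltW. Qed.

Lemma hsum_conj f l : hsum f l -> hsum (fun j => conjc (f j)) (conjc l).
Proof.
move=> hf e /hf [n h]; exists n => m /h; rewrite -cabsJ; apply: le_trans.
by rewrite rmorphB /= /psum rmorph_sum.
Qed.

Lemma hsum_le f l M : hsum f l -> absum f M -> cabs l <= M.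
Proof.
move=> hf fM; apply/ler_addgt0Pr => e /hf [n /(_ n (leqnn _)) h].
rewrite (_ : l = psum f n - (psum f n - l)); last by ring.
apply: le_trans (cabsB _ _) (lerD _ h).
exact: le_trans (psum_cabs _ _) (fM n).
Qed.

(** Symmetric windows are not translation invariant: a shift by one gains one boundary term and
    loses another. Absolute summability makes both tend to zero; general shifts follow by induction
    and reflection. *)
Lemma hsum_shift f l M (k : int) : absum f M -> hsum f l -> hsum (fun j => f (j + k)) l.
Proof.
have pos g L (m : nat) : absum g M -> hsum g L -> hsum (fun j => g (j + m%:Z)) L.
  elim: m g => [|m IH] g gM gL.
    by rewrite (_ : (fun j => _) = g)//; apply/funext => j; rewrite addr0.
  rewrite (_ : (fun j => _) = (fun j => g (j + 1 + m%:Z))); last first.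
    by apply/funext => j; congr g; lia.
  pose h (j : int) := g (j + m%:Z).
  have hL : hsum h L by exact: IH.
  have hM : absum h M.
    by move=> n; apply: le_trans (psum_translate _ _ (fun j => cabs_ge0 (g j))) _.
  have cc : cvgn (psum (fun j => cabs (h j))).
    by apply: psum_cvg hM => j; rewrite ger0_norm ?cabs_ge0.
  move=> e e0; have e3 : 0 < e / 3 by rewrite divr_gt0.
  have [n1 h1] := hL _ e3.
  (* Each boundary term is at most a difference of consecutive partial sums of the moduli, both
     within e/6 of their limit. *)
  have e6 : 0 < e / 6 by rewrite divr_gt0.
  have [n2 h2] := (cvgn_eps _ _).1 cc _ e6.
  exists (maxn n1 n2).+1 => -[//|n]; rewrite ltnS geq_max => /andP[/leqW hn1 hn2].
  rewrite (psum_shift h n.+1 : psum (fun j : int => g (j + 1 + m%:Z)) n.+1 = _).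
  have t1 : cabs (h n.+2) <= e / 3.
    have := h2 _ (leqW (leqW hn2)); have := h2 _ (leqW hn2).
    rewrite (psumS _ n.+1); move: (cabs_ge0 (h (- n.+2%:Z))).
    move: (limn _) (psum _ _) => a b; rewrite !ler_norml => H /andP[? ?] /andP[? ?]; lra.
  have t2 : cabs (h (- n.+1%:Z)) <= e / 3.
    have := h2 _ (leqW hn2); have := h2 _ hn2.
    rewrite (psumS _ n); move: (cabs_ge0 (h (n.+1%:Z))).
    move: (limn _) (psum _ _) => a b; rewrite !ler_norml => H /andP[? ?] /andP[? ?]; lra.
  have t3 := h1 _ hn1.
  rewrite (_ : _ - L = (psum h n.+1 - L) + (h n.+2 - h (- n.+1%:Z))); last by ring.
  apply: le_trans (cabsD _ _) _.
  have := cabsB (h n.+2) (h (- n.+1%:Z)); lra.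
move=> fM fl; case: (ltP k 0) => hk.
  rewrite (_ : (fun j => _) = (fun j => (fun i => f (- i)) (- j + `|k|%N%:Z))).
    have M' : absum (fun i => f (- i)) M.
      by move=> n; rewrite (psum_opp (fun j => cabs (f j))).
    exact: (hsum_opp (pos _ _ `|k|%N M' (hsum_opp fl))).
  by apply/funext => j; congr f; lia.
rewrite (_ : (fun j => _) = (fun j => f (j + `|k|%N%:Z))); first exact: (pos f l `|k|%N).
by apply/funext => j; congr f; lia.
Qed.

Lemma hsum_tail f l u G : (forall j, cabs (f j) <= u j) ->
  (forall n, psum u n <= G) -> hsum f l ->
  forall n, cabs (l - psum f n) <= G - psum u n.
Proof.
move=> fu uG fl n; apply/ler_addgt0Pr => e /fl [m0 h].
set m := maxn m0 n; have {h} h := h m (leq_maxl _ _).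
have u0 j : 0 <= u j by apply: le_trans (fu j); exact: cabs_ge0.
have diff : cabs (psum f m - psum f n) <= psum u m - psum u n.
  have : (n <= m)%N by exact: leq_maxr.
  elim: m {h} => [|m IH]; first by rewrite leqn0 => /eqP ->; rewrite !subrr cabs0.
  rewrite leq_eqVlt => /orP [/eqP ->|]; first by rewrite !subrr cabs0.
  rewrite ltnS => /IH h; rewrite !psumS.
  rewrite (_ : _ - _ = (psum f m - psum f n) + (f m.+1 + f (- m.+1%:Z))); last by ring.
  apply: le_trans (cabsD _ _) _; have := cabsD (f m.+1) (f (- m.+1%:Z)).
  have := fu m.+1; have := fu (- m.+1%:Z); lra.
rewrite (_ : l - _ = (psum f m - psum f n) - (psum f m - l)); last by ring.
apply: le_trans (cabsB _ _) _; have := uG m; lra.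
Qed.

(** The sum of finitely many rows is the sum over j of truncated columns; column j is truncated with
    an error at most [v j] times the tail of [u], and summing over j leaves V times that tail. *)
Lemma hsum_fubini (F : int -> int -> C) (r c : int -> C) (u v : int -> R) (U V : R) l :
  (forall i j, cabs (F i j) <= u i * v j) ->
  (forall n, psum u n <= U) -> (forall n, psum v n <= V) ->
  (forall i, 0 <= u i) -> (forall j, 0 <= v j) ->
  (forall i, hsum (F i) (r i)) -> (forall j, hsum (F^~ j) (c j)) ->
  hsum c l -> hsum r l.
Proof.
move=> Fuv uU vV u0 v0 hr hc cl.
have V0 : 0 <= V by apply: le_trans (vV 0%N); exact: psum_ge0.
have cu : cvgn (psum u) by apply: psum_cvg uU => j; rewrite ger0_norm.
(* The exact total of [u]: with the mere upper bound [U] the tail would not tend to zero. *)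
set U' := limn (psum u).
have uU' n : psum u n <= U'.
  by apply: nondecreasing_cvgn_le => // a b; exact: psum_mono.
have key n : cabs (l - psum r n) <= (U' - psum u n) * V.
  have h1 : hsum (fun j => psum (F^~ j) n) (psum r n).
    rewrite /psum; move: (n + n).+1 => m.
    elim: m => [|m IH].
      rewrite big_ord0 (_ : (fun j => _) = (fun=> 0)); first exact: hsum0.
      by apply/funext => j; rewrite big_ord0.
    rewrite big_ord_recr /= (_ : (fun j => _) =
      (fun j => \sum_(i < m) F (i%:Z - n%:Z) j + F (m%:Z - n%:Z) j)).
      exact: hsumD.
    by apply/funext => j; rewrite big_ord_recr.
  apply: hsum_le (hsumB cl h1) _ => m.
  rewrite mulrC.
  apply: (@le_trans _ _ (psum (fun j => v j * (U' - psum u n)) m)).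
    apply: psum_le => j.
    have H := @hsum_tail (F^~ j) (c j) (fun i => v j * u i) (v j * U') _ _ (hc j) n.
    apply: le_trans (H _ _) _ => [i|p|]; first by rewrite mulrC.
    - by rewrite psumZ ler_wpM2l.
    - by rewrite psumZ mulrBr.
  rewrite (_ : psum _ _ = psum v m * (U' - psum u n)).
    by rewrite ler_wpM2r// subr_ge0.
  by rewrite mulrC -psumZ; apply: eq_bigr => j _; rewrite mulrC.
move=> e e0; have d0 : 0 < e / (V + 1) by rewrite divr_gt0// ltr_wpDl.
have [n0 h] := (cvgn_eps _ _).1 cu _ d0; exists n0 => n /h H.
rewrite cabs_distC; apply: le_trans (key n) _.
have : U' - psum u n <= e / (V + 1) by move: H; rewrite ler_norml => /andP[]; rewrite -/U'; lra.
move=> /(ler_wpM2r V0) /le_trans -> //.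
by rewrite mulrAC ler_pdivrMr ?ltr_wpDl// ler_pM2l//; lra.
Qed.

End UnorderedSums.

(** * The convolution ring of rapidly decreasing sequences *)

Section SmoothSequences.
Variable R : realType.
Local Notation C := R[i].
Implicit Types (a b c : seqC R) (k : int).

Definition wbound m a (M : R) := forall k, jbr R k ^+ m * cabs (a k) <= M.

Lemma psum_jbr n : psum (fun j => jbr R j ^- 2) n <= 5.
Proof.
(* Telescoping comparison: the two new terms 2 / (1 + x^2), x = n + 1, are at most 4/x - 4/(x +
   1). *)
suff : psum (fun j => jbr R j ^- 2) n <= 5 - 4 / n.+1%:R.
  move=> /le_trans; apply; rewrite lerBlDr lerDl; exact: divr_ge0.
elim: n => [|n IH]; first by rewrite psum0 jbr0 expr1n; lra.
rewrite psumS jbrN -addrA; apply: le_trans (lerD IH (lexx _)) _.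
rewrite jbr2 -[_%:~R]/(n.+1%:R).
have x0 : 0 <= n%:R :> R by [].
rewrite -[n.+2%:R]natr1 -[n.+1%:R]natr1; set x : R := n%:R in x0 *.
have -> : 5 - 4 / (x + 1) + ((1 + (x + 1) ^+ 2)^-1 + (1 + (x + 1) ^+ 2)^-1)
  = 5 - 4 / (x + 1 + 1) - (4 / ((x + 1) * (x + 1 + 1)) - 2 / (1 + (x + 1) ^+ 2)).
  have h1 : x + 1 != 0 by lra.
  have h2 : x + 1 + 1 != 0 by lra.
  have h3 : 1 + (x + 1) ^+ 2 != 0 by nra.
  by field; rewrite h1 h2 h3.
rewrite gerBl subr_ge0 ler_pdivrMr; last by nra.
rewrite mulrAC ler_pdivlMr; nra.
Qed.

Lemma absum_jbr (f : int -> C) (M : R) :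
  (forall j, cabs (f j) <= M * jbr R j ^- 2) -> absum f (5 * M).
Proof.
move=> H n.
have M0 : 0 <= M.
  have := H 0; rewrite jbr0 expr1n invr1 mulr1; exact: le_trans (cabs_ge0 _).
apply: le_trans (psum_le _ H) _; rewrite psumZ mulrC ler_wpM2r//; exact: psum_jbr.
Qed.

Lemma wbound_absum a M : wbound 2 a M -> absum a (5 * M).
Proof.
move=> H; apply: absum_jbr => j.
by rewrite ler_pdivlMr ?exprn_gt0 ?jbr_gt0// mulrC.
Qed.

Lemma wbound_ge0 m a M : wbound m a M -> 0 <= M.
Proof. by move=> /(_ 0); apply: le_trans; rewrite mulr_ge0 ?cabs_ge0 ?exprn_ge0 ?jbr_ge0. Qed.

Lemma wbound_le m a M M' : M <= M' -> wbound m a M -> wbound m a M'.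
Proof. by move=> MM H k; exact: le_trans (H k) MM. Qed.

Lemma wboundD m a b M M' : wbound m a M -> wbound m b M' -> wbound m (addS a b) (M + M').
Proof.
move=> ha hb k; apply: le_trans (lerD (ha k) (hb k)).
by rewrite -mulrDr ler_wpM2l ?cabsD// exprn_ge0// jbr_ge0.
Qed.

Lemma wboundN m a M : wbound m a M -> wbound m (fun k => - a k) M.
Proof. by move=> ha k; rewrite cabsN. Qed.

Lemma wboundZ m z a M : wbound m a M -> wbound m (fun k => z * a k) (cabs z * M).
Proof. by move=> ha k; rewrite cabsM mulrCA ler_wpM2l// cabs_ge0. Qed.

Lemma wbound_cj m a M : wbound m a M -> wbound m (cj a) M.
Proof. by move=> ha k; rewrite /cj cabsJ -(jbrN R k). Qed.

Definition ds a : seqC R := fun k => (k%:~R : R)%:C * a k.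

Lemma wbound_ds m a M : wbound m.+1 a M -> wbound m (ds a) M.
Proof.
move=> ha k; rewrite /ds cabsM cabsR; apply: le_trans (ha k).
rewrite exprSr -mulrA ler_wpM2l ?exprn_ge0 ?jbr_ge0// ler_wpM2r ?cabs_ge0//.
exact: jbr_abs.
Qed.

(** The weight is distributed by [jbrD], at the cost of 2^m; the two extra powers demanded of [a]
    provide the summable factor <j>^-2. *)
Lemma conv_term m a b M M' : wbound m.+2 a M -> wbound m b M' -> forall k j,
  jbr R k ^+ m * cabs (a j * b (k - j)) <= 2 ^+ m * M * M' * jbr R j ^- 2.
Proof.
move=> ha hb k j; rewrite ler_pdivlMr ?exprn_gt0 ?jbr_gt0// cabsM.
have p x := @jbr_ge0 R x.
apply: (@le_trans _ _ (2 ^+ m * (jbr R j ^+ m.+2 * cabs (a j)) * (jbr R (k - j) ^+ m * cabs (b (k - j))))).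
  rewrite [leLHS](_ : _ = jbr R k ^+ m * (cabs (a j) * cabs (b (k - j)) * jbr R j ^+ 2)); last by ring.
  rewrite [leRHS](_ : _ = (2 * jbr R j * jbr R (k - j)) ^+ m * (cabs (a j) * cabs (b (k - j)) * jbr R j ^+ 2)); last first.
    by rewrite !exprMn -[m.+2]addn2 (exprD _ m 2); ring.
  rewrite ler_wpM2r ?mulr_ge0 ?cabs_ge0 ?exprn_ge0 ?p//.
  rewrite lerXn2r ?nnegrE ?p ?mulr_ge0 ?p// -{1}(subrK j k) addrC; exact: jbrD.
rewrite -(mulrA (2 ^+ m)) -(mulrA (2 ^+ m)) ler_wpM2l ?exprn_ge0//.
by apply: ler_pM (ha j) (hb (k - j)); rewrite mulr_ge0 ?cabs_ge0 ?exprn_ge0 ?p.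
Qed.

Lemma conv_absum m a b M M' : wbound m.+2 a M -> wbound m b M' -> forall k,
  absum (fun j => a j * b (k - j)) (2 ^+ m * 5 * M * M' / jbr R k ^+ m).
Proof.
move=> ha hb k; rewrite [X in absum _ X](_ : _ = 5 * (2 ^+ m * M * M' / jbr R k ^+ m)); last by rewrite -!mulrA mulrCA.
apply: absum_jbr => j; rewrite mulrAC ler_pdivlMr ?exprn_gt0 ?jbr_gt0//.
by rewrite mulrC; exact: conv_term.
Qed.

Lemma conv_hsum a b : smooth_data a -> smooth_data b -> forall k,
  hsum (fun j => a j * b (k - j)) (mulS a b k).
Proof.
move=> /(_ 2%N) [M ha] /(_ 0%N) [M' hb] k.
exact: absum_hsum (@conv_absum 0 a b M M' ha hb k).
Qed.

Lemma wbound_conv m a b M M' : wbound m.+2 a M -> wbound m b M' ->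
  wbound m (mulS a b) (2 ^+ m * 5 * M * M').
Proof.
move=> ha hb k; have H := conv_absum ha hb k.
rewrite mulrC -ler_pdivlMr ?exprn_gt0 ?jbr_gt0//.
exact: hsum_le (absum_hsum H) H.
Qed.

Lemma smooth_absum a : smooth_data a -> exists M, absum a M.
Proof. by move=> /(_ 2%N) [M /wbound_absum]; exists (5 * M). Qed.

Lemma mulS_comm a b : smooth_data a -> smooth_data b -> mulS a b = mulS b a.
Proof.
move=> sa sb; apply/funext => k; apply/esym/hsum_sumZ.
have [M ha] := sa 2%N; have [M' hb] := sb 0%N.
have hM : absum (fun j => a (- j) * b (k - - j)) (2 ^+ 0 * 5 * M * M' / jbr R k ^+ 0).
  by move=> n; rewrite (psum_opp (fun j => cabs (a j * b (k - j)))); exact: conv_absum.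
have := hsum_shift (- k) hM (hsum_opp (conv_hsum sa sb k)).
congr hsum; apply/funext => j.
by rewrite mulrC; congr (b _ * a _); ring.
Qed.

(** Fubini for the double family a(i) b(j - i) c(k - j): bounding [b] by its supremum leaves a
    majorant of product form. *)
Lemma mulS_assoc a b c : smooth_data a -> smooth_data b -> smooth_data c ->
  smooth_data (mulS a b) -> smooth_data (mulS b c) ->
  mulS a (mulS b c) = mulS (mulS a b) c.
Proof.
move=> sa sb sc sab sbc; apply/funext => k; apply: hsum_sumZ.
have [Ma ha] := smooth_absum sa; have [Mb hb] := sb 0%N; have [Mc hc] := smooth_absum sc.
have Mb0 : 0 <= Mb by apply: wbound_ge0 hb.
have hc' n : psum (fun j => cabs (c (k - j))) n <= Mc.
  rewrite -psum_opp; apply: (@le_trans _ _ (psum (fun j => cabs (c (j + k))) n)).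
    by apply: psum_le => j; rewrite (_ : k - - j = j + k)//; ring.
  exact: le_trans (psum_translate n k (fun j => cabs_ge0 (c j))) (hc _).
apply: (@hsum_fubini _ (fun i j => a i * b (j - i) * c (k - j)) _
    (fun j => mulS a b j * c (k - j)) (fun i => Mb * cabs (a i)) (fun j => cabs (c (k - j)))
    (Mb * Ma) Mc).
- move=> i j; rewrite !cabsM ler_wpM2r ?cabs_ge0// mulrC ler_wpM2r ?cabs_ge0//.
  by have := hb (j - i); rewrite expr0 mul1r.
- by move=> n; rewrite psumZ ler_wpM2l.
- exact: hc'.
- by move=> i; rewrite mulr_ge0 ?cabs_ge0.
- by move=> j; exact: cabs_ge0.
- move=> i; rewrite (_ : (fun j => _) = (fun j => a i * (b (j - i) * c (k - j)))).
    apply: hsumZ.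
    have [M2 hb2] := sb 2%N; have [M0 hc0] := sc 0%N.
    have := hsum_shift (- i) (@conv_absum 0 b c _ _ hb2 hc0 (k - i)) (conv_hsum sb sc (k - i)).
    by congr hsum; apply/funext => j; congr (_ * c _); ring.
  by apply/funext => j; rewrite mulrA.
- move=> j; rewrite mulrC (_ : (fun i => _) = (fun i => c (k - j) * (a i * b (j - i)))).
    by apply: hsumZ; exact: conv_hsum.
  by apply/funext => i; rewrite mulrC.
- exact: conv_hsum.
Qed.

(** Bundling turns C^oo(T) into a commutative ring under convolution, so that the abstract
    differential identities and the [ring] tactic apply to functions directly. *)
Record smooth := Smooth { smval :> int -> R[i]; smoothP : smooth_data smval }.

Lemma smooth_inj (x y : smooth) : (forall k, x k = y k) -> x = y.
Proof.
case: x y => [x hx] [y hy] /= /funext e; case: y / e hy => hy.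
by congr Smooth; exact: Prop_irrelevance.
Qed.

HB.instance Definition _ := gen_eqMixin smooth.
HB.instance Definition _ := gen_choiceMixin smooth.

Lemma smooth_add a b : smooth_data a -> smooth_data b -> smooth_data (addS a b).
Proof. by move=> ha hb m; have [M h] := ha m; have [M' h'] := hb m; exists (M + M'); exact: wboundD. Qed.

Lemma smooth_opp a : smooth_data a -> smooth_data (fun k => - a k).
Proof. by move=> ha m; have [M h] := ha m; exists M; exact: wboundN. Qed.

Lemma smooth_scale z a : smooth_data a -> smooth_data (fun k => z * a k).
Proof. by move=> ha m; have [M h] := ha m; exists (cabs z * M); exact: wboundZ. Qed.

Lemma smooth_conv a b : smooth_data a -> smooth_data b -> smooth_data (mulS a b).
Proof.
move=> ha hb m; have [M h] := ha m.+2; have [M' h'] := hb m.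
by exists (2 ^+ m * 5 * M * M'); exact: wbound_conv.
Qed.

Lemma smooth_cj a : smooth_data a -> smooth_data (cj a).
Proof. by move=> ha m; have [M h] := ha m; exists M; exact: wbound_cj. Qed.

Lemma smooth_ds a : smooth_data a -> smooth_data (ds a).
Proof. by move=> ha m; have [M h] := ha m.+1; exists M; exact: wbound_ds. Qed.

Definition basis (n k : int) : C := (k == n)%:R.

Lemma smooth_basis n : smooth_data (basis n).
Proof.
move=> m; exists (jbr R n ^+ m) => k; rewrite /basis; case: eqP => [->|_].
  by rewrite cabs1 mulr1.
by rewrite cabs0 mulr0 exprn_ge0// jbr_ge0.
Qed.

Lemma smooth_zero : smooth_data (fun=> 0 : C).
Proof. by move=> m; exists 0 => k; rewrite cabs0 mulr0. Qed.

Definition sm_add (x y : smooth) := Smooth (smooth_add (smoothP x) (smoothP y)).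
Definition sm_opp (x : smooth) := Smooth (smooth_opp (smoothP x)).
Definition sm_mul (x y : smooth) := Smooth (smooth_conv (smoothP x) (smoothP y)).
Definition mode n := Smooth (smooth_basis n).

Lemma sm_addA : associative sm_add.
Proof. by move=> x y z; apply: smooth_inj => k /=; rewrite /addS addrA. Qed.
Lemma sm_addC : commutative sm_add.
Proof. by move=> x y; apply: smooth_inj => k /=; rewrite /addS addrC. Qed.
Lemma sm_add0 : left_id (Smooth smooth_zero) sm_add.
Proof. by move=> x; apply: smooth_inj => k /=; rewrite /addS add0r. Qed.
Lemma sm_addN : left_inverse (Smooth smooth_zero) sm_opp sm_add.
Proof. by move=> x; apply: smooth_inj => k /=; rewrite /addS addNr. Qed.

HB.instance Definition _ := GRing.isZmodule.Build smooth sm_addA sm_addC sm_add0 sm_addN.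

Lemma sm_mulA : associative sm_mul.
Proof.
move=> x y z; apply: smooth_inj => k /=.
by rewrite (mulS_assoc (smoothP x) (smoothP y) (smoothP z))//; apply: smooth_conv; apply: smoothP.
Qed.

Lemma sm_mulC : commutative sm_mul.
Proof. by move=> x y; apply: smooth_inj => k /=; rewrite (mulS_comm (smoothP x) (smoothP y)). Qed.

Lemma psum_single (V : zmodType) (f : int -> V) n m :
  (forall k, k != n -> f k = 0) -> (`|n| <= m)%N -> psum f m = f n.
Proof.
move=> H; elim: m => [|m IH].
  by rewrite leqn0 absz_eq0 => /eqP ->; rewrite psum0.
rewrite leq_eqVlt => /orP [/eqP h|h].
  have z : psum f m = 0.
    rewrite /psum big1// => i _; apply: H; apply/eqP => E; have := ltn_ord i; lia.
  have [e1|e1] : n = m.+1%:Z \/ n = - m.+1%:Z by lia.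
    by rewrite psumS z e1 (H (- m.+1%:Z)) ?add0r ?addr0//; lia.
  by rewrite psumS z (H m.+1%:Z) ?e1 ?add0r //; lia.
by rewrite psumS IH// (H m.+1%:Z) ?(H (- m.+1%:Z)) ?addr0//; lia.
Qed.

Lemma hsum_single (f : int -> C) n : (forall k, k != n -> f k = 0) -> hsum f (f n).
Proof.
move=> H e e0; exists `|n|%N => m hm.
by rewrite (psum_single H hm) subrr cabs0 ltW.
Qed.

Lemma mode_mulE n (x : smooth) k : sm_mul (mode n) x k = x (k - n).
Proof.
apply: hsum_sumZ; rewrite -[x (k - n)]mul1r -[1](_ : basis n n = 1); last by rewrite /basis eqxx.
apply: (@hsum_single (fun j => basis n j * x (k - j)) n) => j /negPf h.
by rewrite /basis h mul0r.
Qed.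

Lemma sm_mul1 : left_id (mode 0) sm_mul.
Proof. by move=> x; apply: smooth_inj => k; rewrite mode_mulE subr0. Qed.

Lemma sm_mulDl : left_distributive sm_mul sm_add.
Proof.
move=> x y z; apply: smooth_inj => k /=; apply: hsum_sumZ.
have := hsumD (conv_hsum (smoothP x) (smoothP z) k) (conv_hsum (smoothP y) (smoothP z) k).
by congr hsum; apply/funext => j; rewrite mulrDl.
Qed.

Lemma sm_one_neq0 : mode 0 != Smooth smooth_zero.
Proof. by apply/eqP => /(congr1 (fun x : smooth => x 0)) /= /eqP; rewrite /basis eqxx oner_eq0. Qed.

HB.instance Definition _ := GRing.Zmodule_isComNzRing.Build smooth
  sm_mulA sm_mulC sm_mul1 sm_mulDl sm_one_neq0.

End SmoothSequences.

(** * Derivative, conjugation and constants in the ring of smooth functions *)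

Section SmoothOperations.
Variable R : realType.
Local Notation C := R[i].
Local Notation A := (smooth R).
Implicit Types (x y u : A) (z w : C) (k : int).

Definition der x : A := Smooth (smooth_ds (smoothP x)).
Definition con x : A := Smooth (smooth_cj (smoothP x)).
(** The constant function z. Scalars act through multiplication by it, which keeps all computations
    inside the commutative ring. *)
Definition kst z : A := Smooth (smooth_scale z (smooth_basis R 0)).

Lemma smvalD x y k : (x + y) k = x k + y k. Proof. by []. Qed.
Lemma smvalN x k : (- x) k = - x k. Proof. by []. Qed.
Lemma smvalB x y k : (x - y) k = x k - y k. Proof. by []. Qed.
Lemma smval_mul x y : smval (x * y) = mulS x y. Proof. by []. Qed.
Lemma smval_add x y : smval (x + y) = addS x y. Proof. by []. Qed.
Lemma derE x k : der x k = (k%:~R)%:C * x k. Proof. by []. Qed.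
Lemma conE x k : con x k = conjc (x (- k)). Proof. by []. Qed.
Lemma kstE z k : kst z k = z * basis R 0 k. Proof. by []. Qed.

Lemma kst_mulE z x k : (kst z * x) k = z * x k.
Proof.
apply: hsum_sumZ => /=; have -> : x k = 1 * x (k - 0) by rewrite subr0 mul1r.
rewrite -[1](_ : basis R 0 0 = 1) // mulrA.
apply: (@hsum_single _ (fun j => z * basis R 0 j * x (k - j)) 0) => j /negPf h.
by rewrite /basis h mulr0 mul0r.
Qed.

Lemma mode_shift n x k : (mode R n * x) k = x (k - n).
Proof. exact: mode_mulE. Qed.

Lemma derD x y : der (x + y) = der x + der y.
Proof. by apply: smooth_inj => k; rewrite smvalD !derE smvalD mulrDr. Qed.

Lemma derM x y : der (x * y) = der x * y + x * der y.
Proof.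
apply: smooth_inj => k; rewrite smvalD derE.
apply: (etrans (esym (hsum_sumZ (hsumZ (k%:~R)%:C (conv_hsum (smoothP x) (smoothP y) k))))).
apply: hsum_sumZ.
have := hsumD (conv_hsum (smoothP (der x)) (smoothP y) k) (conv_hsum (smoothP x) (smoothP (der y)) k).
congr hsum; apply/funext => j; rewrite -[X in X + _]/((j%:~R)%:C * x j * y (k - j)).
rewrite -[X in _ + X]/(x j * (((k - j)%:~R)%:C * y (k - j))) [(k - j)%:~R]rmorphB /= rmorphB /=; ring.
Qed.

Lemma conD x y : con (x + y) = con x + con y.
Proof. by apply: smooth_inj => k; rewrite smvalD !conE smvalD conjD. Qed.

Lemma conN x : con (- x) = - con x.
Proof. by apply: smooth_inj => k; rewrite smvalN !conE smvalN conjN. Qed.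

Lemma conM x y : con (x * y) = con x * con y.
Proof.
apply: smooth_inj => k; rewrite conE; apply/esym/hsum_sumZ.
have := hsum_opp (hsum_conj (conv_hsum (smoothP x) (smoothP y) (- k))).
congr hsum; apply/funext => j; rewrite conjM; congr (_ * conjc (y _)); ring.
Qed.

Lemma con_der x : con (der x) = - der (con x).
Proof.
apply: smooth_inj => k; rewrite smvalN conE !derE conE conjM conjc_real mulrNz.
by rewrite RCN mulNr.
Qed.

Lemma kstD z w : kst (z + w) = kst z + kst w.
Proof. by apply: smooth_inj => k; rewrite smvalD !kstE mulrDl. Qed.

Lemma kstN z : kst (- z) = - kst z.
Proof. by apply: smooth_inj => k; rewrite smvalN !kstE mulNr. Qed.

Lemma kstM z w : kst (z * w) = kst z * kst w.
Proof. by apply: smooth_inj => k; rewrite kst_mulE !kstE mulrA. Qed.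

Lemma kst1 : kst 1 = 1.
Proof. by apply: smooth_inj => k; rewrite kstE mul1r. Qed.

Lemma kst_nat n : kst n%:R = n%:R.
Proof.
elim: n => [|n IH]; first by apply: smooth_inj => k; rewrite kstE mul0r.
by rewrite -!natr1 kstD IH kst1.
Qed.

Lemma con_kst z : con (kst z) = kst (conjc z).
Proof.
apply: smooth_inj => k; rewrite conE !kstE conjM; congr (_ * _).
rewrite /basis oppr_eq0. by rewrite conjc_nat.
Qed.

Lemma con_mode n : con (mode R n) = mode R (- n).
Proof. by apply: smooth_inj => k; rewrite conE /= /basis conjc_nat eqr_oppLR. Qed.

Lemma der_mode n : der (mode R n) = kst (n%:~R)%:C * mode R n.
Proof.
apply: smooth_inj => k; rewrite derE kst_mulE /= /basis.
by case: eqP => [->|]; rewrite ?mulr0.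
Qed.

Lemma mode_mul n m : mode R n * mode R m = mode R (n + m).
Proof. by apply: smooth_inj => k; rewrite mode_shift /= /basis subr_eq addrC. Qed.

Lemma der_kst z : der (kst z) = 0.
Proof.
apply: smooth_inj => k; rewrite derE kstE /basis; case: eqP => [->|_].
  by rewrite rmorph0 mul0r.
by rewrite !mulr0.
Qed.

Lemma der0coef x : der x 0 = 0.
Proof. by rewrite derE rmorph0 mul0r. Qed.

(** The nonlinearity multiplied by 2/i and written with D = -i d/dx. The quintic and septic terms
    are set apart because for data of size eps they are O(eps^5), beyond the order of interest. *)
Definition cubic2 (u v : A) : A :=
  2%:R * u ^+ 2 * der (der v) + 8%:R * u * v * der (der u)
   + 4%:R * u * der u * der v + 6%:R * der u ^+ 2 * v.
Definition higher2 (u v : A) : A :=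
  5%:R * u ^+ 4 * v ^+ 3 - 15%:R * u ^+ 2 * v ^+ 2 * der u.
Definition nonlin2 (u v : A) : A := cubic2 u v + higher2 u v.

Lemma nonlinE u : nonlin u = smval (kst ('i%C / 2%:R) * nonlin2 u (con u)).
Proof.
pose dxs x := kst 'i%C * der x.
have dxE x : dx x = smval (dxs x).
  apply/funext => k; rewrite kst_mulE derE /dx imaginaryE; ring.
have cstE z x : Defs.cst z x = smval (kst z * x).
  by apply/funext => k; rewrite kst_mulE.
set v := con u; set i := kst 'i%C; set h := kst (2%:R^-1).
have ii : i * i = -1 by rewrite -kstM -expr2 sqr_i kstN kst1.
have hh : 2%:R * h = 1 by rewrite -kst_nat -kstM mulfV ?pnatr_eq0// kst1.
have dxx : dxs (dxs u) = - der (der u).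
  by rewrite /dxs derM der_kst mul0r add0r mulrA ii mulN1r.
have cdx : con (dxs u) = i * der v.
  by rewrite conM con_der con_kst conji kstN mulrNN.
have cdxx : con (- der (der u)) = - der (der v).
  by rewrite conN !con_der (derN derD) opprK.
rewrite /nonlin ?imaginaryE -[cj u]/(smval v) !dxE dxx -[cj (dxs u)]/(smval (con _)) cdx.
rewrite -[cj (- der (der u))]/(smval (con _)) cdxx -!smval_mul !cstE -!smval_add.
apply: (congr1 (@smval R)).
rewrite !(kstN, kstM, kst_nat) -/i -/h /dxs -/i /nonlin2 /cubic2 /higher2.
move: (der (der u)) (der (der v)) (der u) (der v) => u2 v2 u1 v1.
apply/eqP; rewrite -subr_eq0; apply/eqP.
(* The relations i^2 = -1 and 2h = 1 are unknown to [ring]; the difference of the two sides is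
   displayed as a combination of [i * i + 1] and [1 - 2%:R * h]. *)
transitivity ((i * i + 1) * (- (2%:R * i * u * u1 * v1) - 3%:R * i * u1 ^+ 2 * v)
  + (1 - 2%:R * h) * i * (u ^+ 2 * der v1 + 4%:R * u * v * der u1 + 2%:R * u * u1 * v1 + 3%:R * u1 ^+ 2 * v)).
  by ring.
by rewrite ii hh addNr subrr !mul0r addr0.
Qed.

End SmoothOperations.

(** * Smooth solutions and their conserved quantities *)

Section ComplexDerivatives.
Variable R : realType.
Local Notation C := R[i].

(** Stated with [Num.min] and [Num.max] because difference quotients are later needed on both sides
    of a given time. *)
Lemma mvt_le (f df : R -> R) (a b K : R) :
  (forall x, Num.min a b <= x <= Num.max a b -> is_derive x 1 f (df x)) ->
  (forall x, Num.min a b <= x <= Num.max a b -> `|df x| <= K) ->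
  `|f b - f a| <= K * `|b - a|.
Proof.
wlog ab : a b / a <= b.
  move=> H; case/orP: (le_total a b) => [/H //|/H h]; rewrite distrC (distrC b).
  by rewrite minC maxC; exact: h.
rewrite (min_idPl ab) (max_idPr ab) => hd hK.
have hd' x : x \in `]a, b[ -> is_derive x 1 f (df x).
  by move=> /itvP h; apply: hd; rewrite !h.
have fc : {within `[a, b], continuous f}%classic.
  by apply: derivable_within_continuous => x; rewrite in_itv /= => /hd [].
have [c hc ->] := MVT_segment ab hd' fc.
by rewrite normrM ler_wpM2r// hK//; move: hc; rewrite in_itv.
Qed.

(** The factor 2 is the price of treating real and imaginary parts separately. *)
Lemma cderiv_mvt (g dg : R -> C) (a b K : R) :
  (forall x, Num.min a b <= x <= Num.max a b -> cderiv g x (dg x)) ->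
  (forall x, Num.min a b <= x <= Num.max a b -> cabs (dg x) <= K) ->
  cabs (g b - g a) <= 2 * K * `|b - a|.
Proof.
move=> hd hK; apply: le_trans (cabs_le _) _; rewrite ReD ImD ReN ImN.
have := @mvt_le (fun x => complex.Re (g x)) (fun x => complex.Re (dg x)) a b K
  (fun x h => (hd x h).1) (fun x h => le_trans (Re_cabs _) (hK x h)).
have := @mvt_le (fun x => complex.Im (g x)) (fun x => complex.Im (dg x)) a b K
  (fun x h => (hd x h).2) (fun x h => le_trans (Im_cabs _) (hK x h)).
lra.
Qed.

Lemma cderiv_ext (f g : R -> C) t D : f =1 g -> cderiv f t D -> cderiv g t D.
Proof. by move=> /funext ->. Qed.

Lemma cderivB (f g : R -> C) t D E : cderiv f t D -> cderiv g t E ->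
  cderiv (fun x => f x - g x) t (D - E).
Proof.
move=> [fr fi] [gr gi]; split.
- rewrite ReD ReN (_ : (fun x => _) = (fun x => complex.Re (f x)) - (fun x => complex.Re (g x))).
    exact: is_deriveB.
  by apply/funext => x; rewrite ReD ReN.
- rewrite ImD ImN (_ : (fun x => _) = (fun x => complex.Im (f x)) - (fun x => complex.Im (g x))).
    exact: is_deriveB.
  by apply/funext => x; rewrite ImD ImN.
Qed.

Lemma cderivM (f g : R -> C) t D E : cderiv f t D -> cderiv g t E ->
  cderiv (fun x => f x * g x) t (D * g t + f t * E).
Proof.
move=> [fr fi] [gr gi]; split.
- rewrite (_ : (fun x => _) = (fun x => complex.Re (f x)) * (fun x => complex.Re (g x))
     - (fun x => complex.Im (f x)) * (fun x => complex.Im (g x))); last first.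
    by apply/funext => x; rewrite cReM.
  apply: is_derive_eq (is_deriveB (is_deriveM fr gr) (is_deriveM fi gi)) _.
  rewrite ReD !cReM /GRing.scale /=; ring.
- rewrite (_ : (fun x => _) = (fun x => complex.Re (f x)) * (fun x => complex.Im (g x))
     + (fun x => complex.Im (f x)) * (fun x => complex.Re (g x))); last first.
    by apply/funext => x; rewrite cImM.
  apply: is_derive_eq (is_deriveD (is_deriveM fr gi) (is_deriveM fi gr)) _.
  rewrite ImD !cImM /GRing.scale /=; ring.
Qed.

Lemma cderiv_cst (c : C) t : cderiv (fun=> c) t 0.
Proof. by split; exact: is_derive_cst. Qed.

Lemma cderiv_id t : cderiv (fun x : R => x%:C) t 1.
Proof. by split; [exact: is_derive_id|exact: is_derive_cst]. Qed.

Definition cis (x : R) : C := cos x +i* sin x.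

Lemma cabs_cis x : cabs (cis x) = 1.
Proof. by rewrite /cabs /= cos2Dsin2 sqrtr1. Qed.

Lemma cis0 : cis 0 = 1.
Proof. by rewrite /cis cos0 sin0. Qed.

Lemma cderiv_cis w t : cderiv (fun x => cis (w * x)) t ('i%C * w%:C * cis (w * t)).
Proof.
have dl : is_derive t 1 (fun x => w * x) w.
  rewrite (_ : (fun x => _) = w *: id :> (R -> R)) //.
  by apply: is_derive_eq; rewrite /GRing.scale /= mulr1.
split.
- apply: is_derive_eq (is_derive1_comp (is_derive_cos (w * t)) dl) _.
  by rewrite !cReM !cImM /=; ring.
- apply: is_derive_eq (is_derive1_comp (is_derive_sin (w * t)) dl) _.
  by rewrite !cImM !cReM /=; ring.
Qed.

End ComplexDerivatives.

(** * Continuity and differentiability of curves in C^oo(T) *)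

Section SmoothCurves.
Variable R : realType.
Local Notation C := R[i].
Local Notation A := (smooth R).
Implicit Types (U V Phi : R -> A) (t : R).

Definition ccont U t := forall m (e : R), 0 < e ->
  exists2 del, 0 < del & forall s, `|s - t| < del -> wbound m (U s - U t) e.

Lemma ccont_cst (x : A) t : ccont (fun=> x) t.
Proof.
move=> m e e0; exists 1 => // s _ k; rewrite subrr cabs0 mulr0; exact: ltW.
Qed.

Lemma ccontD U V t : ccont U t -> ccont V t -> ccont (fun s => U s + V s) t.
Proof.
move=> hU hV m e e0; have e2 : 0 < e / 2 by rewrite divr_gt0.
have [d1 d10 h1] := hU m _ e2; have [d2 d20 h2] := hV m _ e2.
exists (Num.min d1 d2) => [|s]; rewrite lt_min ?d10// => /andP[/h1 H1 /h2 H2].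
rewrite opprD addrACA (splitr e); exact: wboundD.
Qed.

Lemma ccontN U t : ccont U t -> ccont (fun s => - U s) t.
Proof.
move=> hU m e /(hU m) [d d0 h]; exists d => // s /h H.
rewrite -opprD; exact: wboundN.
Qed.

Lemma ccont_der U t : ccont U t -> ccont (fun s => der (U s)) t.
Proof.
move=> hU m e /(hU m.+1) [d d0 h]; exists d => // s /h H.
rewrite -(derN (@derD R)) -derD; exact: wbound_ds.
Qed.

Lemma ccont_con U t : ccont U t -> ccont (fun s => con (U s)) t.
Proof.
move=> hU m e /(hU m) [d d0 h]; exists d => // s /h H.
rewrite -conN -conD; exact: wbound_cj.
Qed.

Lemma ccontM U V t : ccont U t -> ccont V t -> ccont (fun s => U s * V s) t.
Proof.
move=> hU hV m e e0.
have [KU hKU] := smoothP (U t) m.+2; have [KV hKV] := smoothP (V t) m.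
have KU0 := wbound_ge0 hKU; have KV0 := wbound_ge0 hKV.
set c : R := 2 ^+ m * 5.
have c0 : 0 < c by rewrite mulr_gt0// exprn_gt0.
have B0 : 0 < c * (1 + KU + KV) by rewrite mulr_gt0//; lra.
(* With d <= 1 the three error terms d d, d KV and KU d add up to at most d (1 + KU + KV). *)
set d := Num.min 1 (e / (c * (1 + KU + KV))).
have d0 : 0 < d by rewrite lt_min ltr01 divr_gt0.
have d1 : d <= 1 by rewrite ge_min lexx.
have de : d * (c * (1 + KU + KV)) <= e by rewrite -ler_pdivlMr// ge_min lexx orbT.
have [a1 a10 h1] := hU m.+2 _ d0; have [a2 a20 h2] := hV m _ d0.
exists (Num.min a1 a2) => [|s]; rewrite lt_min ?a10// => /andP[/h1 H1 /h2 H2].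
rewrite (_ : _ - _ = (U s - U t) * (V s - V t) + (U s - U t) * V t + U t * (V s - V t)); last by ring.
apply: wbound_le (wboundD (wboundD (wbound_conv H1 H2) (wbound_conv H1 hKV)) (wbound_conv hKU H2)).
rewrite -/c; have : c * d * d <= c * d * 1 by rewrite ler_wpM2l// mulr_ge0// ltW.
nra.
Qed.

(* Caratheodory's form of differentiability, for the topology of all weighted sup norms. *)
Definition cdiff U t (X : A) := exists Phi, [/\ ccont Phi t, Phi t = X &
  forall s, U s = U t + kst (s - t)%:C * Phi s].

Lemma ccont_kst t : ccont (fun s => kst (s - t)%:C) t.
Proof.
move=> m e e0; exists e => // s /ltW hs k; rewrite -kstN -kstD kstE subrr subr0.
rewrite /basis; case: eqP => [->|_]; last by rewrite mulr0 cabs0 mulr0 ltW.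
by rewrite jbr0 expr1n mul1r mulr1 cabsR.
Qed.

Lemma cdiff_cont U t X : cdiff U t X -> ccont U t.
Proof.
move=> [Phi [hP _ hU]]; rewrite (funext hU).
by apply: ccontD; [exact: ccont_cst|apply: ccontM hP; exact: ccont_kst].
Qed.

Lemma cdiffD U V t X Y : cdiff U t X -> cdiff V t Y -> cdiff (fun s => U s + V s) t (X + Y).
Proof.
move=> [P [hP <- hU]] [Q [hQ <- hV]]; exists (fun s => P s + Q s); split => //.
  exact: ccontD.
by move=> s; rewrite hU hV; ring.
Qed.

Lemma cdiff_cst (x : A) t : cdiff (fun=> x) t 0.
Proof. by exists (fun=> 0); split => [||s]; [exact: ccont_cst| |rewrite mulr0 addr0]. Qed.

Lemma cdiffM U V t X Y : cdiff U t X -> cdiff V t Y ->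
  cdiff (fun s => U s * V s) t (X * V t + U t * Y).
Proof.
move=> hU' hV'; have hV := cdiff_cont hV'; case: hU' hV' => [P [hP <- hU]] [Q [hQ <- hQV]].
exists (fun s => P s * V s + U t * Q s); split => //.
  by apply: ccontD; apply: ccontM => //; exact: ccont_cst.
by move=> s; rewrite hU {1 2}hQV; ring.
Qed.

Lemma cdiff_der U t X : cdiff U t X -> cdiff (fun s => der (U s)) t (der X).
Proof.
move=> [P [hP <- hU]]; exists (fun s => der (P s)); split => //; first exact: ccont_der.
by move=> s; rewrite hU derD derM der_kst mul0r add0r.
Qed.

Lemma cdiff_con U t X : cdiff U t X -> cdiff (fun s => con (U s)) t (con X).
Proof.
move=> [P [hP <- hU]]; exists (fun s => con (P s)); split => //; first exact: ccont_con.
by move=> s; rewrite hU conD conM con_kst conjc_real.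
Qed.

Lemma cdiff_coef U t X k : cdiff U t X -> cderiv (fun s => U s k) t (X k).
Proof.
move=> [P [hP <- hU]].
have cont (f : C -> R) : (forall z w, `|f z - f w| <= cabs (z - w)) ->
    {for t, continuous (fun s => f (P s k))}.
  move=> fl; apply/cvgrPdist_le => e e0; have [d d0 h] := hP 0%N _ e0.
  apply/nbhs_ballP; exists d => // s /=; rewrite /ball /= distrC => /h H.
  rewrite distrC; apply: le_trans (fl _ _) _; have := H k; by rewrite expr0 mul1r.
have uE s : U s k - U t k = (s - t)%:C * P s k.
  by rewrite hU smvalD kst_mulE; ring.
split; apply/is_derive1_caratheodory.
- exists (fun s => complex.Re (P s k)); split => //.
    by move=> z; rewrite -ReN -ReD uE cReM /=; ring.
  by apply: cont => z w; rewrite -ReN -ReD Re_cabs.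
- exists (fun s => complex.Im (P s k)); split => //.
    by move=> z; rewrite -ImN -ImD uE cImM /=; ring.
  by apply: cont => z w; rewrite -ImN -ImD Im_cabs.
Qed.

End SmoothCurves.

(** * Mass and energy along a smooth solution *)

Section ConservationLaws.
Variables (R : realType) (T : R) (u : R -> seqC R).
Hypothesis sol : smooth_solution T u.
Local Notation C := R[i].
Local Notation A := (smooth R).
Local Notation D := (@der R).
Implicit Types (t s : R) (k : int).

(** The default 0 can occur only outside (-T, T), where nothing is known about [u]. *)
Definition curve t : A := if pselect (smooth_data (u t)) is left h then Smooth h else 0.

Lemma curveE t : -T < t < T -> smval (curve t) = u t.
Proof. by move=> /sol.1 h; rewrite /curve; case: pselect. Qed.

(** The right-hand side of the equation solved for u_t. As a differential polynomial in the solution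
    it is continuous in time with values in C^oo(T). *)
Definition velocity t : A := kst (- 'i%C / 2%:R) * flow2 D (curve t) (con (curve t)).

Lemma flow2E (x y : A) : flow2 D x y = 2%:R * D (D (D (D x))) - D (nonlin2 x y).
Proof.
rewrite /flow2; congr (_ - D _); rewrite /nonlin2 /cubic2 /higher2; ring.
Qed.

Lemma conK (x : A) : con (con x) = x.
Proof. by apply: smooth_inj => k; rewrite !conE opprK conjcK. Qed.

(** Conjugation anticommutes with [D]. Hence the second differential polynomial is the conjugate
    evolution, and the identities in independent u and v apply to one solution. *)
Lemma con_flow2 (x : A) : con (flow2 D x (con x)) = - flow2b D x (con x).
Proof.
have con_nat n : con (n%:R : A) = n%:R by rewrite -kst_nat con_kst conjc_nat.
have conX (y : A) n : con (y ^+ n) = con y ^+ n.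
  by elim: n => [|n IH]; rewrite ?expr0 ?(con_nat 1%N)// !exprS conM IH.
rewrite /flow2 /flow2b !(con_nat, conX, conD, conN, con_der, conM, conK).
set y := con x; rewrite !(derN (@derD R)) !opprK.
rewrite opprD !opprK; congr (_ + D _); ring.
Qed.

Lemma solution_cderiv t : -T < t < T -> forall k, cderiv (fun s => u s k) t (velocity t k).
Proof.
move=> ht k; have [E [hE eqE]] := sol.2.2 t ht k.
suff -> : velocity t k = E by [].
have i2 : ('i%C : C) ^+ 2 = -1 by exact: sqr_i.
have n2 : (2%:R : C) != 0 by rewrite pnatr_eq0.
rewrite /velocity kst_mulE flow2E smvalB -(kst_nat R 2) kst_mulE.
move: eqE; rewrite -(curveE ht) nonlinE {1 2 3 4 5}/dx imaginaryE kst_mulE !derE.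
set a := k%:~R%:C; set w := nonlin2 _ _ k; set z := curve t k => eqE.
have -> : E = - 'i%C * ('i%C * E) by rewrite mulrA mulNr -expr2 i2 opprK mul1r.
rewrite (_ : 'i%C * E = ('i%C ^+ 2) ^+ 2 * (a ^+ 4 * z) + 'i%C ^+ 2 * (a * w / 2%:R)); last first.
  by rewrite -(subrK ('i%C * a * ('i%C * a * ('i%C * a * ('i%C * a * z)))) ('i%C * E)) eqE; ring.
by rewrite i2 sqrrN expr1n; field.
Qed.

Lemma curve_cont t : -T < t < T -> ccont curve t.
Proof.
move=> ht m e e0; have [d [d0 h]] := sol.2.1 m t ht e e0.
have [h1 h2] := andP ht.
exists (Num.min d (Num.min (T - t) (t + T))) => [|s].
  by rewrite !lt_min d0; apply/andP; split; lra.
rewrite !lt_min => /and3P[hs s1 s2] k.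
have hs' : -T < s < T by move: s1 s2; rewrite !ltr_norml => /andP[? ?] /andP[? ?]; lra.
by rewrite smvalB !curveE//; exact: h.
Qed.

Lemma velocity_cont t : -T < t < T -> ccont velocity t.
Proof.
move=> /curve_cont hU; have hV := ccont_con hU.
have cX (W : R -> A) n : ccont W t -> ccont (fun s => W s ^+ n) t.
  move=> hW; elim: n => [|n IH]; first exact: ccont_cst.
  by rewrite (_ : (fun s => _) = (fun s => W s * W s ^+ n)); [exact: ccontM|apply/funext => s; rewrite exprS].
rewrite /velocity /flow2.
repeat lazymatch goal with
| |- ccont (fun s => @?f s + @?g s) _ => apply: (@ccontD _ f g)
| |- ccont (fun s => @?f s * @?g s) _ => apply: (@ccontM _ f g)
| |- ccont (fun s => - @?f s) _ => apply: (@ccontN _ f)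
| |- ccont (fun s => D (@?f s)) _ => apply: (@ccont_der _ f)
| |- ccont (fun s => (@?f s) ^+ ?n) _ => apply: (cX f n)
| |- ccont (fun s => curve s) _ => exact: hU
| |- ccont curve _ => exact: hU
| |- ccont (fun s => con (curve s)) _ => exact: hV
| |- ccont (fun s => ?c) _ => exact: ccont_cst
end.
Qed.

(** The equation gives derivatives only one coefficient at a time. Subtracting the linear motion
    with velocity frozen at t and applying the mean value inequality bounds the error by the
    variation of the velocity, which is small in each weighted norm uniformly in k. *)
Lemma curve_diff t : -T < t < T -> cdiff curve t (velocity t).
Proof.
move=> ht; have [h1 h2] := andP ht.
exists (fun s => if s == t then velocity t else kst ((s - t)^-1)%:C * (curve s - curve t)).
split; last 2 first.
- by rewrite eqxx.
- move=> s; case: eqP => [->|/eqP hs].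
    by rewrite subrr (_ : kst _ = 0) ?mul0r ?addr0//; apply: smooth_inj => k; rewrite kstE mul0r.
  rewrite mulrA -kstM -RCM mulfV ?subr_eq0// kst1 mul1r; ring.
move=> m e e0; have e4 : 0 < e / 4 by rewrite divr_gt0.
have [d d0 h] := velocity_cont ht m e4.
exists (Num.min d (Num.min (T - t) (t + T))) => [|s].
  by rewrite !lt_min d0; apply/andP; split; lra.
rewrite !lt_min eqxx => /and3P[hs s1 s2] k.
case: eqP => [_|/eqP nst]; first by rewrite subrr cabs0 mulr0 ltW.
have [hs' hd] : -T < s < T /\ - d < s - t < d.
  by move: hs s1 s2; rewrite !ltr_norml => /andP[? ?] /andP[? ?] /andP[? ?]; lra.
have J0 : 0 < jbr R k ^+ m by rewrite exprn_gt0 ?jbr_gt0.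
have st0 : s - t != 0 by rewrite subr_eq0.
rewrite smvalB kst_mulE smvalB !curveE//.
pose g x := u x k - x%:C * velocity t k.
have hg x : Num.min t s <= x <= Num.max t s -> -T < x < T /\ `|x - t| < d.
  move=> /andP[]; rewrite ge_min le_max => /orP H1 /orP H2.
  split; first by apply/andP; case: H1 => ?; case: H2 => ?; split; lra.
  by rewrite ltr_norml; apply/andP; case: H1 => ?; case: H2 => ?; split; lra.
have : cabs (g s - g t) <= 2 * (e / 4 / jbr R k ^+ m) * `|s - t|.
  apply: (cderiv_mvt (dg := fun x => velocity x k - (1 * velocity t k + x%:C * 0))) => x /hg [hx hxd].
    apply: cderivB; first exact: solution_cderiv.
    by apply: cderivM; [exact: cderiv_id|exact: cderiv_cst].
  have -> : 1 * velocity t k + x%:C * 0 = velocity t k :> C by rewrite mul1r mulr0 addr0.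
  by rewrite ler_pdivlMr// mulrC -smvalB; exact: h hxd k.
rewrite /g => H.
rewrite (_ : _ - velocity t k = ((s - t)^-1)%:C * (u s k - s%:C * velocity t k - (u t k - t%:C * velocity t k))); last first.
  rewrite {1}(_ : velocity t k = ((s - t)^-1)%:C * ((s - t)%:C * velocity t k)).
    by rewrite RCD RCN; ring.
  by rewrite mulrA -RCM mulVf// mul1r.
rewrite cabsM cabsR normfV mulrCA ler_pdivrMl ?normr_gt0//.
move: H => /(ler_wpM2l (ltW J0)) /le_trans; apply.
rewrite [leLHS](_ : _ = (jbr R k ^+ m / jbr R k ^+ m) * (e / 2 * `|s - t|)); last by field; rewrite gt_eqF.
rewrite mulfV ?gt_eqF// mul1r mulrC ler_wpM2l//; lra.
Qed.

Lemma con_velocity t : con (velocity t) = kst (- 'i%C / 2%:R) * flow2b D (curve t) (con (curve t)).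
Proof.
rewrite /velocity conM con_flow2 con_kst conjM conjN conji opprK.
rewrite -[2%:R^-1](_ : (2%:R^-1)%:C = _); last by rewrite fmorphV /= RC_nat.
by rewrite conjc_real mulrN -mulNr -kstN -mulNr.
Qed.

Definition mass (x : A) : A := x * con x.
(** Four times the second conserved density. As [D (con x)] is minus the conjugate of [D x], the
    leading term has mean 4 |Dx|^2 in L^2; means are read off as coefficient 0. *)
Definition energy (x : A) : A := - (4%:R * (D x * D (con x)))
  + 3%:R * (x * con x * (x * D (con x) - con x * D x)) + 2%:R * (x * con x) ^+ 3.

Lemma const_coef (W : R -> A) : (forall t, -T < t < T -> cderiv (fun s => W s 0) t 0) ->
  forall t, -T < t < T -> W t 0 = W 0 0.
Proof.
move=> hW t ht; have [h1 h2] := andP ht.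
have : cabs (W t 0 - W 0 0) <= 2 * 0 * `|t - 0|.
  apply: (cderiv_mvt (g := fun s => W s 0) (dg := fun=> 0)) => x hx; last by rewrite cabs0.
  apply: hW; move: hx => /andP[]; rewrite ge_min le_max => /orP H1 /orP H2.
  by case: H1 => ?; case: H2 => ?; lra.
rewrite mulr0 mul0r => H; apply/eqP; rewrite -subr_eq0; apply/eqP/cabs_eq0.
by apply/eqP; rewrite eq_le H cabs_ge0.
Qed.

Lemma mass_conserved t : -T < t < T -> mass (curve t) 0 = mass (curve 0) 0.
Proof.
move: t; apply: const_coef => t ht.
have hU := curve_diff ht; have hV := cdiff_con hU.
have := cdiff_coef 0 (cdiffM hU hV); rewrite con_velocity /velocity.
set X := flow2 _ _ _; set Y := flow2b _ _ _; congr cderiv.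
have [f hf] := mass_flux (@derD R) (@derM R) (curve t) (con (curve t)).
rewrite (_ : _ + _ = kst (- 'i%C / 2%:R) * (X * con (curve t) + curve t * Y)); last by ring.
rewrite kst_mulE; have := congr1 (fun x : A => x 0) hf.
rewrite der0coef -(kst_nat R 4) kst_mulE => /eqP; rewrite mulf_eq0 pnatr_eq0 /= => /eqP ->.
by rewrite mulr0.
Qed.

Lemma energy_conserved t : -T < t < T -> energy (curve t) 0 = energy (curve 0) 0.
Proof.
move: t; apply: const_coef => t ht.
have hU := curve_diff ht; have hV := cdiff_con hU.
have hDU := cdiff_der hU; have hDV := cdiff_der hV.
have hUV := cdiffM hU hV.
have hN n := cdiff_cst (n%:R : A) t.
(* Subtraction is encoded as multiplication by the constant -1, so the sum and product rules
   suffice. *)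
have hM1 := cdiff_cst (- 1 : A) t.
have h1 := cdiffM hM1 (cdiffM (hN 4%N) (cdiffM hDU hDV)).
have h2 := cdiffM (hN 3%N) (cdiffM hUV (cdiffD (cdiffM hU hDV) (cdiffM hM1 (cdiffM hV hDU)))).
have h3 := cdiffM (hN 2%N) (cdiffM hUV (cdiffM hUV hUV)).
have := cdiff_coef 0 (cdiffD (cdiffD h1 h2) h3).
rewrite con_velocity /velocity.
set X := flow2 _ _ _; set Y := flow2b _ _ _; set x := curve t; set y := con x.
have [f] := energy_flux (@derD R) (@derM R) x y; rewrite -/X -/Y => hf.
move=> H; apply: (@cderiv_ext _ _ (fun s => energy (curve s) 0) _ _ _ _); last first.
  have -> : 0 = (kst (- 'i%C / 2%:R) * D f) 0 by rewrite kst_mulE der0coef mulr0.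
  rewrite -hf; move: H; congr cderiv; apply: (congr1 (fun w : A => w 0)).
  by rewrite !derM !der_kst; ring.
move=> s; apply: (congr1 (fun w : A => w 0)); rewrite /energy; ring.
Qed.

End ConservationLaws.

(** * Estimates in H^1 *)

Section SobolevBounds.
Variable R : realType.
Local Notation C := R[i].
Local Notation A := (smooth R).
Local Notation D := (@der R).
Implicit Types (x y z v w : A) (k : int) (X Y Z : R).

(** Weighted arithmetic-geometric mean inequality with weight l = (Y + d) / (X + d); the positive
    shift d covers the cases where X or Y vanishes. *)
Lemma cauchy_schwarz (f g : int -> R) X Y n : 0 <= X -> 0 <= Y ->
  psum (fun j => f j ^+ 2) n <= X ^+ 2 -> psum (fun j => g j ^+ 2) n <= Y ^+ 2 ->
  psum (fun j => f j * g j) n <= X * Y.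
Proof.
move=> X0 Y0 hf hg.
apply/ler_addgt0Pr => e e0.
set d := Num.min 1 (e / (X + Y + 1)).
have s0 : 0 < X + Y + 1 by lra.
have d0 : 0 < d by rewrite lt_min ltr01 divr_gt0.
have d1 : d <= 1 by rewrite ge_min lexx.
have de : d * (X + Y + 1) <= e by rewrite -ler_pdivlMr// ge_min lexx orbT.
have Xd : 0 < X + d by lra.
have Yd : 0 < Y + d by lra.
apply: (@le_trans _ _ ((X + d) * (Y + d))); last by nra.
set l := (Y + d) / (X + d); have l0 : 0 < l by rewrite divr_gt0.
have amgm j : f j * g j <= 2^-1 * (l * f j ^+ 2 + l^-1 * g j ^+ 2).
  have li : l * l^-1 = 1 by rewrite mulfV ?gt_eqF.
  have : 0 <= l^-1 * (l * f j - g j) ^+ 2 by rewrite mulr_ge0 ?sqr_ge0// invr_ge0 ltW.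
  rewrite (_ : l^-1 * _ = (l * l^-1) * (l * f j ^+ 2) - 2 * (l * l^-1) * (f j * g j) + l^-1 * g j ^+ 2); last by ring.
  by rewrite li; lra.
apply: le_trans (psum_le _ amgm) _; rewrite psumZ psumD !psumZ.
have lX : l * (X + d) = Y + d by rewrite /l divfK ?gt_eqF.
have lY : l^-1 * (Y + d) = X + d by rewrite -lX mulKf ?gt_eqF.
have h1 : l * psum (fun j => f j ^+ 2) n <= (X + d) * (Y + d).
  rewrite -lX mulrCA ler_wpM2l ?(ltW l0)//; apply: le_trans hf _; nra.
have h2 : l^-1 * psum (fun j => g j ^+ 2) n <= (X + d) * (Y + d).
  rewrite -lY -mulrA ler_wpM2l ?invr_ge0 ?(ltW l0)//; apply: le_trans hg _; nra.
lra.
Qed.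

Definition l2bound x X := forall n, psum (fun j => cabs (x j) ^+ 2) n <= X ^+ 2.
Definition h1bound x X :=
  0 <= X /\ forall n, psum (fun j => (jbr R j * cabs (x j)) ^+ 2) n <= X ^+ 2.
Definition supbound x X := forall k, cabs (x k) <= X.

Lemma supbound_ge0 x X : supbound x X -> 0 <= X.
Proof. by move=> /(_ 0); apply: le_trans; exact: cabs_ge0. Qed.

Lemma l2_sup x y X Y : 0 <= X -> 0 <= Y -> l2bound x X -> l2bound y Y -> supbound (x * y) (X * Y).
Proof.
move=> X0 Y0 hx hy k; apply: hsum_le (conv_hsum (smoothP x) (smoothP y) k) _ => n.
rewrite (_ : psum _ n = psum (fun j => cabs (x j) * cabs (y (k - j))) n); last first.
  by apply: eq_bigr => j _; rewrite cabsM.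
apply: cauchy_schwarz => //; rewrite -psum_opp.
apply: (@le_trans _ _ (psum (fun j => cabs (y (j + k)) ^+ 2) n)).
  by apply: psum_le => j; rewrite (_ : k - - j = j + k)//; ring.
exact: le_trans (psum_translate n k (fun j => sqr_ge0 (cabs (y j)))) (hy _).
Qed.

Lemma l1_sup x y X Y : absum x X -> supbound y Y -> supbound (x * y) (X * Y).
Proof.
move=> hx hy k; apply: hsum_le (conv_hsum (smoothP x) (smoothP y) k) _ => n.
have Y0 := supbound_ge0 hy.
apply: (@le_trans _ _ (psum (fun j => Y * cabs (x j)) n)).
  by apply: psum_le => j; rewrite cabsM mulrC ler_wpM2r ?cabs_ge0.
by rewrite psumZ mulrC ler_wpM2r.
Qed.

Lemma h1_l2 x X : h1bound x X -> l2bound x X.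
Proof.
move=> [_ h] n; apply: le_trans (h n); apply: psum_le => j.
rewrite exprMn; have := jbr_expn_ge1 R j 2; have := sqr_ge0 (cabs (x j)); nra.
Qed.

Lemma h1_l2_der x X : h1bound x X -> l2bound (D x) X.
Proof.
move=> [_ h] n; apply: le_trans (h n); apply: psum_le => j.
rewrite derE cabsM cabsR !exprMn ler_wpM2r ?sqr_ge0//.
by rewrite lerXn2r ?nnegrE ?jbr_ge0 ?jbr_abs.
Qed.

(** Cauchy-Schwarz against <j>^-1, whose square sum is at most 5 <= 3^2. *)
Lemma h1_absum x X : h1bound x X -> absum x (3 * X).
Proof.
move=> [X0 h] n.
rewrite (_ : psum _ n = psum (fun j => (jbr R j)^-1 * (jbr R j * cabs (x j))) n); last first.
  by apply: eq_bigr => j _; rewrite mulrA mulVf ?mul1r// gt_eqF// jbr_gt0.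
apply: cauchy_schwarz (h n) => //.
rewrite (_ : psum _ n = psum (fun j => jbr R j ^- 2) n).
  by apply: le_trans (psum_jbr R n) _; rewrite expr2; lra.
by apply: eq_bigr => j _; rewrite exprVn.
Qed.

Lemma h1_sup x X : h1bound x X -> supbound x X.
Proof.
move=> [X0 h] k; rewrite -(@ler_pXn2r _ 2) ?nnegrE ?cabs_ge0//.
apply: le_trans (h `|k|%N).
apply: le_trans (psum_term k (fun j => sqr_ge0 (jbr R j * cabs (x j)))).
rewrite exprMn; have := jbr_expn_ge1 R k 2; have := sqr_ge0 (cabs (x k)); nra.
Qed.

Lemma h1_con x X : h1bound x X -> h1bound (con x) X.
Proof.
move=> [X0 h]; split=> // n; apply: le_trans (h n).
rewrite -psum_opp; apply: psum_le => j.
by rewrite conE cabsJ opprK jbrN.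
Qed.

Lemma supboundD x y X Y : supbound x X -> supbound y Y -> supbound (x + y) (X + Y).
Proof. by move=> hx hy k; apply: le_trans (cabsD _ _) (lerD (hx k) (hy k)). Qed.

Lemma supboundN x X : supbound x X -> supbound (- x) X.
Proof. by move=> hx k; rewrite smvalN cabsN. Qed.

Lemma supbound_nat n x X : supbound x X -> supbound (n%:R * x) (n%:R * X).
Proof.
move=> hx k; rewrite -(kst_nat R n) kst_mulE cabsM -RC_nat cabsR.
by rewrite ger0_norm// ler_wpM2l.
Qed.

Lemma supbound_le x X Y : X <= Y -> supbound x X -> supbound x Y.
Proof. by move=> XY h k; exact: le_trans (h k) XY. Qed.

(** The undifferentiated factor is taken in l^1, the other two in l^2, where each can afford one
    derivative. *)
Lemma h1_trilin x y z X Y Z : h1bound x X -> h1bound y Y -> h1bound z Z ->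
  supbound (x * (y * z)) (3 * X * Y * Z) /\
  supbound (x * (y * D z)) (3 * X * Y * Z) /\
  supbound (x * (D y * D z)) (3 * X * Y * Z).
Proof.
move=> hx hy hz; have [Y0 Z0] := (hy.1, hz.1); rewrite -(mulrA (3 * X)).
split; last split; apply: l1_sup (h1_absum hx) _; apply: l2_sup => //.
- exact: h1_l2. - exact: h1_l2. - exact: h1_l2. - exact: h1_l2_der.
- exact: h1_l2_der. - exact: h1_l2_der.
Qed.

(** Its mean is the square of the H^1 norm. Being polynomial in x, Dx and their conjugates, it is
    differentiable along solutions, which gives the time continuity of the norm. *)
Definition h1form x : A := mass x - D x * D (con x).

Lemma h1form_hsum x :
  hsum (fun j => ((jbr R j * cabs (x j)) ^+ 2)%:C) (h1form x 0).
Proof.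
have h1 := conv_hsum (smoothP x) (smoothP (con x)) 0.
have h2 := conv_hsum (smoothP (D x)) (smoothP (D (con x))) 0.
have := hsumB h1 h2; congr hsum; apply/funext => j.
rewrite -[smval (con x)]/(cj x) sub0r /cj opprK.
rewrite -[smval (D x)]/(ds x) -[smval (D (con x))]/(ds (cj x)) /ds /cj opprK.
rewrite mulrNz RCN exprMn jbr2 RCM -mulcJ RCD RCX; ring.
Qed.

Definition h1sq x : R := complex.Re (h1form x 0).

Lemma h1sq_lim x e : 0 < e -> exists m, forall n, (m <= n)%N ->
  `|psum (fun j => (jbr R j * cabs (x j)) ^+ 2) n - h1sq x| <= e.
Proof.
move=> /(h1form_hsum x) [m h]; exists m => n /h; apply: le_trans.
have := Re_cabs (psum (fun j => ((jbr R j * cabs (x j)) ^+ 2)%:C) n - h1form x 0).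
by rewrite ReD ReN Re_psum.
Qed.

Lemma h1sq_le x n : psum (fun j => (jbr R j * cabs (x j)) ^+ 2) n <= h1sq x.
Proof.
apply/ler_addgt0Pr => e /(h1sq_lim x) [m h].
have := h (maxn m n) (leq_maxl _ _); rewrite ler_norml => /andP[_].
have := @psum_mono R (fun j => (jbr R j * cabs (x j)) ^+ 2) n (maxn m n) (fun j => sqr_ge0 _) (leq_maxr _ _).
lra.
Qed.

Lemma h1sq_ge0 x : 0 <= h1sq x.
Proof. by apply: le_trans (h1sq_le x 0); exact: psum_ge0 (fun j => sqr_ge0 _). Qed.

Lemma h1sq_bound x : h1bound x (Num.sqrt (h1sq x)).
Proof. by split; [exact: sqrtr_ge0|move=> n; rewrite sqr_sqrtr ?h1sq_ge0// h1sq_le]. Qed.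

Lemma h1sq_upper x M : (forall n, psum (fun j => (jbr R j * cabs (x j)) ^+ 2) n <= M) -> h1sq x <= M.
Proof.
move=> H; apply/ler_addgt0Pr => e /(h1sq_lim x) [m /(_ m (leqnn _))].
by rewrite ler_norml => /andP[]; have := H m; lra.
Qed.

Definition energy_rest x : A :=
  3%:R * (x * con x * (x * D (con x) - con x * D x)) + 2%:R * (x * con x) ^+ 3.

Lemma energyE x : energy x = 4%:R * (h1form x - mass x) + energy_rest x.
Proof. rewrite /energy /h1form /energy_rest; ring. Qed.

(** Each factor taken in l^1 costs 3. The quartic terms give 3 (9 + 9) = 54, the sextic one 2 times
    81 = 162, and X^6 <= X^4. *)
Lemma energy_rest_le x X : X <= 1 -> h1bound x X -> supbound (energy_rest x) (216 * X ^+ 4).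
Proof.
move=> X1 hx; have hv := h1_con hx; have X0 := hx.1; set v := con x.
have [l1x l1v] := (h1_absum hx, h1_absum hv).
have a1 := l1_sup l1x (h1_trilin hv hx hv).2.1.
have a2 := l1_sup l1x (h1_trilin hv hv hx).2.1.
have a3 := l1_sup l1x (l1_sup l1v (l1_sup l1x (h1_trilin hv hx hv).1)).
have := supboundD (supbound_nat 3 (supboundD a1 (supboundN a2))) (supbound_nat 2 a3).
rewrite (_ : _ + _ = energy_rest x); last by rewrite /energy_rest -/v; ring.
apply: supbound_le; rewrite -/v.
have : X ^+ 6 <= X ^+ 4 by rewrite ler_wiXn2l.
by rewrite -[3%:R]/(3 : R) -[2%:R]/(2 : R); lra.
Qed.

End SobolevBounds.

Lemma energy_coef (R : realType) (x : smooth R) (k : int) :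
  energy x k = 4%:R * (h1form x k - mass x k) + energy_rest x k.
Proof.
rewrite energyE (smvalD (4%:R * (h1form x - mass x)) (energy_rest x)).
by rewrite -(kst_nat R 4) kst_mulE smvalB.
Qed.

(** The equal masses cancel, and 54 = 216 / 4. *)
Lemma balance_le (R : realType) (a b m r r0 : R[i]) (A B : R) :
  4%:R * (a - m) + r = 4%:R * (b - m) + r0 -> cabs r <= 216 * A -> cabs r0 <= 216 * B ->
  `|complex.Re a - complex.Re b| <= 54 * (A + B).
Proof.
move=> h rA rB; have four : 4%:R * (a - b) = r0 - r.
  rewrite -[r0](addKr (4%:R * (b - m))) -h; ring.
have := Re_cabs (a - b); rewrite ReD ReN.
have := cabsB r0 r; rewrite -four cabsM -RC_nat cabsR ger0_norm//.
rewrite -[4%:R]/(4 : R); lra.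
Qed.

(** If [f t] exceeded [2 * f 0], that value would be attained at some time, where the balance gives
    f 0 <= 54 (4 + 1) (f 0)^2 = 270 (f 0)^2; this is incompatible with 0 < 300 f 0 <= 1. Inserting f
    t <= 2 f 0 in the balance gives the second bound. *)
Lemma continuity_bootstrap (R : realType) (f : R -> R) (t : R) :
  0 <= t -> {within `[0, t], continuous f}%classic ->
  (forall s, 0 <= s <= t -> 0 <= f s) -> 0 < f 0 -> 300 * f 0 <= 1 ->
  (forall s, 0 <= s <= t -> f s <= 1 -> f 0 <= 1 ->
    `|f s - f 0| <= 54 * (f s ^+ 2 + f 0 ^+ 2)) ->
  f t <= 2 * f 0 /\ `|f t - f 0| <= 270 * f 0 ^+ 2.
Proof.
move=> t0 cont f_ge0 q0 q1 bal.
have f01 : f 0 <= 1 by lra.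
have ft : f t <= 2 * f 0.
  rewrite leNgt; apply/negP => big.
  have mm : Num.min (f 0) (f t) <= 2 * f 0 <= Num.max (f 0) (f t).
    by rewrite ge_min le_max (ltW big) orbT andbT; apply/orP; left; lra.
  have [c hc fc] := IVT t0 cont mm; rewrite in_itv /= in hc.
  have := bal c hc; rewrite fc => H.
  have h2 : 2 * f 0 <= 1 by lra.
  move: (H h2 f01); rewrite ger0_norm; last by lra.
  nra.
split=> //; have ht : 0 <= t <= t by rewrite t0 lexx.
apply: le_trans (bal t ht _ f01) _; first by lra.
have := f_ge0 t ht; nra.
Qed.

(** * A priori H^1 bound and evolution of single modes *)

Section Dynamics.
Variables (R : realType) (T : R) (u : R -> seqC R).
Hypothesis sol : smooth_solution T u.
Local Notation C := R[i].
Local Notation A := (smooth R).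
Local Notation D := (@der R).
Local Notation U := (curve u).
Implicit Types (t s : R) (k : int).

Lemma h1form_diff t : -T < t < T -> exists X, cdiff (fun s => h1form (U s)) t X.
Proof.
move=> ht; have hU := curve_diff sol ht; have hV := cdiff_con hU.
have hDD := cdiffM (cdiff_der hU) (cdiff_der hV).
have := cdiffD (cdiffM hU hV) (cdiffM (cdiff_cst (- 1 : A) t) hDD).
set X := _ + _ => H; exists X; move: H; congr cdiff.
by apply/funext => s; rewrite mulN1r.
Qed.

Lemma h1sq_balance t : -T < t < T -> h1sq (U t) <= 1 -> h1sq (U 0) <= 1 ->
  `|h1sq (U t) - h1sq (U 0)| <= 54 * (h1sq (U t) ^+ 2 + h1sq (U 0) ^+ 2).
Proof.
move=> ht Qt1 Q01; have := energy_conserved sol ht; have := mass_conserved sol ht.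
rewrite !energy_coef => -> eqE.
have rest (x : A) : h1sq x <= 1 -> cabs (energy_rest x 0) <= 216 * h1sq x ^+ 2.
  move=> x1; have s1 : Num.sqrt (h1sq x) <= 1 by rewrite -sqrtr1 ler_wsqrtr.
  have e4 : Num.sqrt (h1sq x) ^+ 4 = h1sq x ^+ 2.
    by rewrite -[in RHS](sqr_sqrtr (h1sq_ge0 x)) -exprM.
  by rewrite -e4; exact: energy_rest_le s1 (h1sq_bound x) 0.
exact: balance_le eqE (rest _ Qt1) (rest _ Q01).
Qed.

Lemma h1_apriori t : 0 <= t < T -> 0 < h1sq (U 0) -> 300 * h1sq (U 0) <= 1 ->
  h1sq (U t) <= 2 * h1sq (U 0) /\
  `|h1sq (U t) - h1sq (U 0)| <= 270 * h1sq (U 0) ^+ 2.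
Proof.
move=> /andP[t0 tT] Q0 Q1.
have inT s : 0 <= s <= t -> -T < s < T by move=> /andP[? ?]; apply/andP; split; lra.
apply: (@continuity_bootstrap _ (fun s => h1sq (U s))) => //.
- apply: derivable_within_continuous => s; rewrite in_itv /= => hs.
  by have [X /(cdiff_coef 0) [[]]] := h1form_diff (inT _ hs).
- by move=> s _; exact: h1sq_ge0.
- by move=> s hs Qs Q0'; exact: h1sq_balance (inT _ hs) Qs Q0'.
Qed.

(** Every term of the right-hand side is an x-derivative, so the mean is exactly constant. *)
Lemma mode0_const t : -T < t < T -> U t 0 = U 0 0.
Proof.
move: t; apply: const_coef => t ht.
have := cdiff_coef 0 (curve_diff sol ht); congr cderiv.
by rewrite /velocity kst_mulE flow2E -(kst_nat R 2) smvalB kst_mulE !der0coef subr0 !mulr0.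
Qed.

(** The factor e^{i k^4 t} removes the linear part, leaving only the nonlinear forcing: Duhamel's
    formula in differential form. *)
Lemma rotated_mode_cderiv (k : int) t : -T < t < T ->
  cderiv (fun s => cis ((k%:~R) ^+ 4 * s) * U s k) t
    (cis ((k%:~R) ^+ 4 * t) * ('i%C * (k%:~R / 2)%:C * nonlin2 (U t) (con (U t)) k)).
Proof.
move=> ht; have := cderivM (cderiv_cis ((k%:~R) ^+ 4) t) (cdiff_coef k (curve_diff sol ht)).
congr cderiv.
rewrite /velocity kst_mulE flow2E smvalB -(kst_nat R 2) kst_mulE !derE.
rewrite RCX RCM; set a := k%:~R%:C; set w := nonlin2 _ _ k; set z := U t k; set e := cis _.
have n2 : (2%:R : C) != 0 by rewrite pnatr_eq0.
have -> : (2%:R^-1)%:C = 2%:R^-1 :> C.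
  by apply: (mulfI n2); rewrite mulfV// -RC_nat -RCM mulfV ?pnatr_eq0.
by field.
Qed.

End Dynamics.

(** * Bounds for the nonlinearity and its value on two modes *)

Section CubicForm.
Variable R : realType.
Local Notation C := R[i].
Local Notation A := (smooth R).
Local Notation D := (@der R).
Implicit Types (x y z w a b c : A) (X Y Z W : R).

Lemma cubic2E x y : cubic2 x y =
  D (2%:R * (x * (x * D y)) + 8%:R * (x * (y * D x)))
  - (8%:R * (x * (D x * D y)) + 2%:R * (y * (D x * D x))).
Proof. exact: (cubic_by_parts (@derD R) (@derM R)). Qed.

Lemma supbound_der x X (k : int) : supbound x X -> cabs (D x k) <= `|k%:~R| * X.
Proof. by move=> h; rewrite derE cabsM cabsR ler_wpM2l. Qed.

(** Telescoping: one factor is replaced at a time, with three differences of size 3 Z^2 W. *)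
Lemma h1_trilin_diff a b c a' b' c' Z W :
  h1bound a Z -> h1bound b Z -> h1bound c Z -> h1bound a' Z -> h1bound b' Z -> h1bound c' Z ->
  h1bound (a - a') W -> h1bound (b - b') W -> h1bound (c - c') W ->
  supbound (a * (b * D c) - a' * (b' * D c')) (9 * Z ^+ 2 * W) /\
  supbound (a * (D b * D c) - a' * (D b' * D c')) (9 * Z ^+ 2 * W).
Proof.
move=> ha hb hc ha' hb' hc' da db dc.
have [_ [p1 q1]] := h1_trilin da hb hc.
have [_ [p2 q2]] := h1_trilin ha' db hc.
have [_ [p3 q3]] := h1_trilin ha' hb' dc.
have derB x y : D (x - y) = D x - D y by rewrite derD (derN (@derD R)).
split.
- have := supboundD (supboundD p1 p2) p3.
  rewrite (_ : _ + _ + _ = a * (b * D c) - a' * (b' * D c')); last by rewrite derB; ring.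
  by apply: supbound_le; lra.
- have := supboundD (supboundD q1 q2) q3.
  rewrite (_ : _ + _ + _ = a * (D b * D c) - a' * (D b' * D c')); last by rewrite !derB; ring.
  by apply: supbound_le; lra.
Qed.

Lemma cubic2_diff x p Z W (k : int) : h1bound x Z -> h1bound p Z -> h1bound (x - p) W ->
  cabs (cubic2 x (con x) k - cubic2 p (con p) k) <= 90 * (`|k%:~R| + 1) * Z ^+ 2 * W.
Proof.
move=> hx hp hw; have [hv hr] := (h1_con hx, h1_con hp).
have hs : h1bound (con x - con p) W by rewrite -conN -conD; exact: h1_con.
have [f1 f2] := h1_trilin_diff hx hx hv hp hp hr hw hw hs.
have [g1 _] := h1_trilin_diff hx hv hx hp hr hp hw hs hw.
have [_ g2] := h1_trilin_diff hv hx hx hr hp hp hs hw hw.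
have e1 := supbound_der k (supboundD (supbound_nat 2 f1) (supbound_nat 8 g1)).
have e2 := supboundD (supbound_nat 8 f2) (supbound_nat 2 g2) k.
rewrite -smvalB !cubic2E (cubic_regroup (@derD R)) smvalB.
apply: le_trans (cabsB _ _) _; apply: le_trans (lerD e1 e2) _.
rewrite -[8%:R]/(8 : R) -[2%:R]/(2 : R); lra.
Qed.

Lemma cubic2_le x Z (k : int) : h1bound x Z ->
  cabs (cubic2 x (con x) k) <= 30 * (`|k%:~R| + 1) * Z ^+ 3.
Proof.
move=> hx; have hv := h1_con hx.
have [_ [f1 f2]] := h1_trilin hx hx hv.
have [_ [g1 _]] := h1_trilin hx hv hx.
have [_ [_ g2]] := h1_trilin hv hx hx.
have e1 := supbound_der k (supboundD (supbound_nat 2 f1) (supbound_nat 8 g1)).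
have e2 := supboundD (supbound_nat 8 f2) (supbound_nat 2 g2) k.
rewrite cubic2E smvalB; apply: le_trans (cabsB _ _) _; apply: le_trans (lerD e1 e2) _.
rewrite -[8%:R]/(8 : R) -[2%:R]/(2 : R); lra.
Qed.

(** 1620 = 5 times 243 + 15 times 27, with Z^7 <= Z^5 for the septic term. *)
Lemma higher2_le x Z : Z <= 1 -> h1bound x Z -> supbound (higher2 x (con x)) (1620 * Z ^+ 5).
Proof.
move=> Z1 hx; have hv := h1_con hx; have Z0 := hx.1.
have [lx lv] := (h1_absum hx, h1_absum hv).
have a1 := l1_sup lx (l1_sup lv (l1_sup lx (l1_sup lv (h1_trilin hx hx hv).1))).
have a2 := l1_sup lx (l1_sup lv (h1_trilin hv hx hx).2.1).
have := supboundD (supbound_nat 5 a1) (supboundN (supbound_nat 15 a2)).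
rewrite (_ : _ - _ = higher2 x (con x)); last by rewrite /higher2; ring.
apply: supbound_le.
have : Z ^+ 7 <= Z ^+ 5 by rewrite ler_wiXn2l.
rewrite -[5%:R]/(5 : R) -[15%:R]/(15 : R); lra.
Qed.

(* Only the resonant interactions N = N - N + N and N = N - 0 + 0 reach the frequency N. *)
Lemma cubic2_two_modes (N : nat) (al be : C) : (0 < N)%N ->
  let p := kst al + kst be * mode R N%:Z in
  cubic2 p (con p) N%:Z =
    (N%:R ^+ 2 * (8 * cabs al ^+ 2 + 12 * cabs be ^+ 2))%:C * be.
Proof.
move=> N0 p; set x := mode R N%:Z; set y := mode R (- N%:Z).
have xy : x * y = 1 by rewrite /x /y mode_mul subrr.
set n := kst (N%:R : R)%:C.
have Dx : D x = n * x by rewrite der_mode.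
have Dy : D y = - (n * y) by rewrite der_mode mulrNz RCN kstN mulNr.
set a := kst al; set b := kst be; set a' := kst (conjc al); set b' := kst (conjc be).
have cp : con p = a' + b' * y by rewrite /p conD conM !con_kst con_mode.
have Dn : D n = 0 by exact: der_kst.
have D1 : D p = n * b * x by rewrite derD derM !der_kst Dx -/b; ring.
have D2 : D (D p) = n ^+ 2 * b * x by rewrite D1 !derM Dn der_kst Dx; ring.
have D3 : D (con p) = - (n * b' * y) by rewrite cp derD derM !der_kst Dy; ring.
have D4 : D (D (con p)) = n ^+ 2 * b' * y.
  by rewrite D3 (derN (@derD R)) !derM Dn der_kst Dy; ring.
pose m : C := (N%:R : R)%:C.
have -> : cubic2 p (con p) =
    kst (m * m * (8%:R * (al * conjc al) + 12%:R * (be * conjc be)) * be) * x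
   + (kst (2%:R * (m * m) * (al * al) * conjc be) * y
     + kst (m * m * (8%:R * al * be * conjc be)) * mode R 0)
   + kst (14%:R * (m * m) * conjc al * (be * be)) * mode R (N%:Z + N%:Z).
  rewrite -mode_mul /cubic2 D2 D4 D1 D3 cp /p !(kstM, kstD, kst_nat) -/n -/a -/b -/a' -/b' -/x.
  rewrite -[mode R 0]/(1 : A).
  (* The expansion is arranged to exhibit every product [x * y], since [ring] does not know that it
     equals 1. *)
  transitivity (2%:R * n ^+ 2 * b' * (a ^+ 2 * y + 2%:R * a * b * (x * y) + b ^+ 2 * x * (x * y))
    + 8%:R * n ^+ 2 * b * (a * a' * x + b * b' * x * (x * y) + a * b' * (x * y) + a' * b * (x * x))
    - 4%:R * n ^+ 2 * b * b' * (a * (x * y) + b * x * (x * y))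
    + 6%:R * n ^+ 2 * b ^+ 2 * (a' * (x * x) + b' * x * (x * y))); first by ring.
  by rewrite xy; ring.
have split4 (X Y Z W : A) (k : int) : (X + (Y + Z) + W) k = X k + (Y k + Z k) + W k by [].
rewrite split4 !kst_mulE /= /basis eqxx.
have -> : (N%:Z == - N%:Z) = false by apply/eqP; lia.
have -> : (N%:Z == 0) = false by apply/eqP; lia.
have -> : (N%:Z == N%:Z + N%:Z) = false by apply/eqP; lia.
rewrite !mulcJ (RCM (N%:R ^+ 2)) (RCX N%:R) -/m (RCD (8 * _)) (RCM 8) (RCM 12) !RC_nat.
move: (cabs al ^+ 2)%:C (cabs be ^+ 2)%:C => A1 A2.
rewrite [nat_of_bool true]/= [nat_of_bool false]/= mulr1n mulr0n. ring.
Qed.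

End CubicForm.

(** * Asymptotics of two-mode solutions *)

Section TwoModes.
Variable R : realType.
Local Notation C := R[i].
Local Notation A := (smooth R).

Lemma psum_delta (k : int) (B : R) n : (`|k| <= n)%N ->
  psum (fun j => (j == k)%:R * B) n = B.
Proof.
move=> kn; rewrite (psum_single (n := k)) ?eqxx ?mul1r// => j /negPf ->.
by rewrite mul0r.
Qed.

Lemma two_mode_sum (f g : int -> R) (k : int) (B E : R) n : k != 0 -> (`|k| <= n)%N ->
  (forall j, g j = f j + ((j == 0)%:R * B + (j == k)%:R * E)) ->
  psum g n = psum f n + (B + E).
Proof.
move=> k0 kn H; rewrite (_ : psum g n = psum (fun j => f j + ((j == 0)%:R * B + (j == k)%:R * E)) n).
  by rewrite psumD psumD !psum_delta.
by apply: eq_bigr => j _; rewrite H.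
Qed.

Definition two_modes (k : int) (al be : C) : A := kst al + kst be * mode R k.

Lemma two_modesE (k : int) (al be : C) j : k != 0 ->
  two_modes k al be j = if j == 0 then al else if j == k then be else 0.
Proof.
move=> k0; rewrite /two_modes smvalD kst_mulE kstE /= /basis.
case: eqP => [->|_]; first by rewrite eq_sym (negPf k0) mulr1 mulr0 addr0.
by case: eqP; rewrite ?mulr1 ?mulr0 add0r.
Qed.

Lemma h1sq_two_modes (k : int) (al be : C) : k != 0 ->
  h1sq (two_modes k al be) <= cabs al ^+ 2 + (jbr R k * cabs be) ^+ 2.
Proof.
move=> k0; apply: h1sq_upper => n.
apply: le_trans (psum_mono (fun j => sqr_ge0 _) (leq_addr `|k|%N n)) _.
rewrite (@two_mode_sum (fun=> 0) _ k (cabs al ^+ 2) ((jbr R k * cabs be) ^+ 2)) ?leq_addl//.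
  by rewrite /psum big1// add0r.
move=> j; rewrite two_modesE// add0r.
case: eqP => [->|_]; first by rewrite [0 == k]eq_sym (negPf k0) jbr0 !mul1r mul0r addr0.
by case: eqP => [->|_]; rewrite ?mul0r ?mul1r ?add0r// cabs0 mulr0 expr0n.
Qed.

(** Pythagoras: the modes are orthogonal. Windows are enlarged by |k| so as to contain both removed
    modes. *)
Lemma h1sq_remainder (k : int) (x : A) : k != 0 ->
  h1sq (x - two_modes k (x 0) (x k)) <= h1sq x - cabs (x 0) ^+ 2 - (jbr R k * cabs (x k)) ^+ 2.
Proof.
move=> k0; apply: h1sq_upper => n.
apply: le_trans (psum_mono (fun j => sqr_ge0 _) (leq_addr `|k|%N n)) _.
have := h1sq_le x (n + `|k|)%N.
rewrite (@two_mode_sum (fun j => (jbr R j * cabs ((x - two_modes k (x 0) (x k)) j)) ^+ 2)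
   (fun j => (jbr R j * cabs (x j)) ^+ 2) k (cabs (x 0) ^+ 2) ((jbr R k * cabs (x k)) ^+ 2)) ?leq_addl//.
  by move: (psum _ _) (h1sq x) (cabs (x 0) ^+ 2) ((_ * _) ^+ 2) => a h b c; lra.
move=> j; rewrite smvalB two_modesE//.
case: eqP => [->|_].
  by rewrite [0 == k]eq_sym (negPf k0) subrr cabs0 mulr0 expr0n add0r jbr0 !mul1r mul0r addr0.
case: eqP => [->|_]; first by rewrite subrr cabs0 mulr0 expr0n !add0r mul0r add0r mul1r.
by rewrite subr0 !mul0r !addr0.
Qed.

Lemma h1_two_modes_le (k : int) (x : A) Z : k != 0 -> h1bound x Z ->
  h1bound (two_modes k (x 0) (x k)) Z.
Proof.
move=> k0 [Z0 h]; split=> // n; apply: le_trans (h n); apply: psum_le => j.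
rewrite two_modesE//; case: eqP => [->//|_]; case: eqP => [->//|_].
by rewrite cabs0 mulr0 expr0n sqr_ge0.
Qed.

End TwoModes.

Section CubeEstimate.
Variable R : realType.
Local Notation C := R[i].

(** The difference is (4 e^2 + 6 |G|^2)(G - a) + 6 a (|G|^2 - a^2), with | |G|^2 - a^2 | <= 2 Z d;
    thus 18 = 6 + 12. *)
Lemma cube_diff (G : C) (a e Z d : R) : 0 <= a -> a <= Z -> cabs G <= Z ->
  cabs (G - a%:C) <= d ->
  cabs ((4 * e ^+ 2 + 6 * cabs G ^+ 2)%:C * G - ((4 * e ^+ 2 + 6 * a ^+ 2) * a)%:C)
    <= (4 * e ^+ 2 + 18 * Z ^+ 2) * d.
Proof.
move=> a0 aZ GZ Gd; have g0 := cabs_ge0 G; have n0 := cabs_ge0 (G - a%:C).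
rewrite (_ : ((4 * e ^+ 2 + 6 * a ^+ 2) * a)%:C =
    (4 * e ^+ 2 + 6 * cabs G ^+ 2)%:C * a%:C - (6 * a * (cabs G ^+ 2 - a ^+ 2))%:C); last first.
  by rewrite -RCM -RCN -RCD; congr (_%:C); ring.
rewrite opprB addrCA addrC -mulrBr.
apply: le_trans (cabsD _ _) _; rewrite cabsM !cabsR.
have g1 : cabs G - a <= d.
  have := cabsD (G - a%:C) a%:C; rewrite subrK cabsR ger0_norm//; lra.
have g2 : a - cabs G <= d.
  have := cabsB G (G - a%:C); rewrite opprB addrC subrK cabsR ger0_norm//; lra.
move: (cabs (G - a%:C)) (cabs G) n0 Gd g0 GZ g1 g2 => D g D0 Dd g0 gZ g1 g2.
have e2 := sqr_ge0 e; move: (e ^+ 2) e2 => E E0.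
have d0 : 0 <= d by lra.
have gg : g ^+ 2 <= Z ^+ 2 by rewrite lerXn2r ?nnegrE//; lra.
rewrite ger0_norm; last by rewrite addr_ge0 ?mulr_ge0 ?sqr_ge0.
rewrite normrM ger0_norm; last by rewrite mulr_ge0.
have s1 : `|g ^+ 2 - a ^+ 2| <= 2 * Z * d.
  rewrite subr_sqr normrM mulrC (ger0_norm (_ : 0 <= g + a)); last by lra.
  apply: ler_pM => //; [by lra|by lra|by rewrite ler_norml; apply/andP; split; lra].
have s2 : 6 * a * `|g ^+ 2 - a ^+ 2| <= 6 * Z * (2 * Z * d).
  by apply: ler_pM => //; lra.
have s3 : (4 * E + 6 * g ^+ 2) * D <= (4 * E + 6 * Z ^+ 2) * d.
  by apply: ler_pM => //; [have := sqr_ge0 g; lra|lra].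
lra.
Qed.

End CubeEstimate.

(** * Expansion of mode N to third order in the amplitude *)

Section Asymptotics.
Variables (R : realType) (T : R) (u : R -> seqC R).
Hypothesis sol : smooth_solution T u.
Variables (N : nat) (b e : R).
Hypotheses (N0 : (0 < N)%N) (b0 : 0 < b) (e0 : 0 < e) (e1 : e <= 1).
Local Notation C := R[i].
Local Notation A := (smooth R).
Local Notation U := (curve u).
Hypothesis init : U 0 = two_modes N%:Z e%:C (e * b)%:C.
Let n : R := N%:R.
Let J : R := jbr R N%:Z.
Let q : R := 1 + (J * b) ^+ 2.
Hypothesis small : 300 * (e ^+ 2 * q) <= 1.
Let z : R := Num.sqrt (2 * q).
Let Z : R := e * z.
Let G (s : R) : C := cis (n ^+ 4 * s) * U s N%:Z.
(** Constants in front of powers of e: [drift] bounds the change of mode N (e^3), [width] the H^1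
    norm of the other modes (e^2), [slope] the error in the time derivative (e^4). None of them
    depends on [e]. Here 1650 = 30 + 1620 collects the cubic and higher terms. *)
Definition drift (t : R) : R := n * 1650 * (n + 1) * z ^+ 3 * t.
Definition width (t : R) : R := Num.sqrt (270 * q ^+ 2 + 2 * J ^+ 2 * b * drift t).
Definition slope (t : R) : R :=
  n / 2 * (90 * (n + 1) * z ^+ 2 * width t + 1620 * z ^+ 5)
  + n ^+ 3 * (4 + 18 * z ^+ 2) * drift t.

Let NZ0 : N%:Z != 0. Proof. by apply/eqP; lia. Qed.

Let n0 : 0 <= n. Proof. exact: ler0n. Qed.

Let q1 : 1 <= q. Proof. by rewrite lerDl sqr_ge0. Qed.

Let z0 : 0 <= z. Proof. exact: sqrtr_ge0. Qed.

Let z2 : z ^+ 2 = 2 * q. Proof. by rewrite sqr_sqrtr// mulr_ge0// (le_trans ler01 q1). Qed.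

Let Z2 : Z ^+ 2 = 2 * (e ^+ 2 * q). Proof. by rewrite exprMn z2; ring. Qed.

Let Z0 : 0 <= Z. Proof. by rewrite mulr_ge0// ltW. Qed.

Let Z1 : Z <= 1.
Proof.
rewrite -(@ler_pXn2r _ 2) ?nnegrE// Z2 expr1n.
by move: (e ^+ 2 * q) small => a; lra.
Qed.

Let G_abs s : cabs (G s) = cabs (U s N%:Z).
Proof. by rewrite cabsM cabs_cis mul1r. Qed.

Let initial_modes : U 0 0 = e%:C /\ U 0 N%:Z = (e * b)%:C.
Proof. by rewrite init !two_modesE// eqxx (negPf NZ0) eqxx. Qed.

Let initial_h1 : e ^+ 2 <= h1sq (U 0) <= e ^+ 2 * q.
Proof.
apply/andP; split.
  apply: le_trans (h1sq_le _ 0); rewrite psum0 jbr0 mul1r initial_modes.1 cabsR.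
  by rewrite real_normK ?num_real.
rewrite init; apply: le_trans (h1sq_two_modes _ _ NZ0) _.
rewrite !cabsR /q -/J !exprMn !real_normK ?num_real// !exprMn.
by rewrite le_eqVlt; apply/orP; left; apply/eqP; ring.
Qed.

Let h1_bounds s : 0 <= s < T ->
  h1bound (U s) Z /\ h1sq (U s) <= e ^+ 2 * q + 270 * (e ^+ 2 * q) ^+ 2.
Proof.
move=> hs; have := initial_h1; set Q := h1sq (U 0) => /andP[Q1 Q2].
have ee : 0 < e ^+ 2 by rewrite exprn_gt0.
have Qpos : 0 < Q by exact: lt_le_trans Q1.
have Q300 : 300 * Q <= 1 by exact: le_trans (ler_wpM2l (ler0n _ 300%N) Q2) small.
have [a1 a2] := h1_apriori sol hs Qpos Q300.
split.
  split=> // k; apply: le_trans (h1sq_le _ k) _; apply: le_trans a1 _.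
  by rewrite Z2 ler_wpM2l.
have {}a2 : h1sq (U s) <= Q + 270 * Q ^+ 2.
  by move: a2; rewrite ler_norml => /andP[_]; rewrite lerBlDl.
have Q0 := ltW Qpos; apply: le_trans a2 (lerD Q2 (ler_wpM2l (ler0n _ 270%N) _)).
by apply: lerXn2r => //; rewrite nnegrE ?Q0// (le_trans Q0 Q2).
Qed.

Let h1_sup_Z s : 0 <= s < T -> cabs (G s) <= Z.
Proof. by move=> /h1_bounds [h _]; rewrite G_abs; exact: h1_sup h _. Qed.

Let G0 : G 0 = (e * b)%:C.
Proof. by rewrite /G mulr0 cis0 mul1r initial_modes.2. Qed.

Let nonlin2_bound s : 0 <= s < T ->
  cabs (nonlin2 (U s) (con (U s)) N%:Z) <= 1650 * (n + 1) * Z ^+ 3.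
Proof.
move=> /h1_bounds [h _]; rewrite /nonlin2 smvalD; apply: le_trans (cabsD _ _) _.
apply: le_trans (lerD (cubic2_le _ h) (higher2_le Z1 h _)) _.
rewrite -[N%:Z%:~R]/n ger0_norm//.
have h5 : Z ^+ 5 <= Z ^+ 3 by rewrite ler_wiXn2l.
have h3 : 0 <= Z ^+ 3 by rewrite exprn_ge0.
have := mulr_ge0 n0 h3; move: (Z ^+ 5) (Z ^+ 3) n h5 h3 => x y m xy y0; lra.
Qed.

Let inT s t : t < T -> 0 <= s <= t -> (0 <= s < T) /\ (-T < s < T).
Proof. by move=> tT /andP[s0 st]; split; apply/andP; split; lra. Qed.

Let minmax (s t : R) : 0 <= t -> Num.min 0 t <= s <= Num.max 0 t -> 0 <= s <= t.
Proof. by move=> t0; rewrite (min_idPl t0) (max_idPr t0). Qed.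

Let drift_coef_ge0 : 0 <= n * 1650 * (n + 1) * z ^+ 3.
Proof.
apply: mulr_ge0 (exprn_ge0 3 z0).
exact: mulr_ge0 (mulr_ge0 n0 (ler0n _ 1650%N)) (addr_ge0 n0 ler01).
Qed.

Lemma drift_mono s t : s <= t -> drift s <= drift t.
Proof. exact: ler_wpM2l drift_coef_ge0 _ _. Qed.

Let mode_drift s : 0 <= s < T -> cabs (G s - (e * b)%:C) <= drift s * e ^+ 3.
Proof.
move=> /andP[s0 sT]; rewrite -G0.
have := @cderiv_mvt _ G (fun x => cis (n ^+ 4 * x) * ('i%C * (n / 2)%:C * nonlin2 (U x) (con (U x)) N%:Z))
  0 s (n / 2 * (1650 * (n + 1) * Z ^+ 3)).
have -> : 2 * (n / 2 * (1650 * (n + 1) * Z ^+ 3)) * `|s - 0| = drift s * e ^+ 3.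
  by rewrite subr0 ger0_norm// /drift /Z exprMn; move: (z ^+ 3) (e ^+ 3) => x y; field.
apply=> x /(minmax s0) /(inT sT) [hx hx'].
  exact: (rotated_mode_cderiv sol N%:Z hx').
rewrite !cabsM cabs_cis cabsi cabsR !mul1r ger0_norm ?divr_ge0//.
by rewrite ler_wpM2l ?divr_ge0// nonlin2_bound.
Qed.

Let drift_ge0 s : 0 <= s -> 0 <= drift s.
Proof. exact: mulr_ge0 drift_coef_ge0. Qed.

(** The H^1 norm squared is e^2 q up to 270 e^4 q^2, and modes 0 and N carry e^2 q of it up to 2 J^2
    (e b) (drift e^3), so what is left for the other modes is of order e^4. *)
Let remainder_h1 s : 0 <= s < T ->
  h1bound (U s - two_modes N%:Z (U s 0) (U s N%:Z)) (width s * e ^+ 2).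
Proof.
move=> hs; have [s0 sT] := andP hs; set w := _ - _.
have d0 := drift_ge0 s0.
have w0 : 0 <= 270 * q ^+ 2 + 2 * J ^+ 2 * b * drift s.
  exact: addr_ge0 (mulr_ge0 (ler0n _ 270%N) (sqr_ge0 q))
    (mulr_ge0 (mulr_ge0 (mulr_ge0 (ler0n _ 2%N) (sqr_ge0 J)) (ltW b0)) d0).
have e2 : 0 <= e ^+ 2 by exact: sqr_ge0.
split=> [|k]; first by rewrite mulr_ge0 ?sqrtr_ge0.
apply: le_trans (h1sq_le _ k) _; apply: le_trans (h1sq_remainder _ NZ0) _.
rewrite (exprMn _ (width s)) (sqr_sqrtr w0) (exprMn _ (jbr R _)) -/J.
have -> : U s 0 = e%:C by rewrite (mode0_const sol) ?initial_modes.1//; have [] := inT sT (_ : 0 <= s <= s); rewrite ?s0 ?lexx.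
rewrite cabsR real_normK ?num_real//.
have eb : 0 <= e * b by rewrite mulr_ge0// ltW.
have yx : e * b <= cabs (U s N%:Z) + cabs (G s - (e * b)%:C).
  have := cabsB (G s) (G s - (e * b)%:C).
  by rewrite opprB addrC subrK cabsR ger0_norm// G_abs.
have [_] := h1_bounds hs; have := mode_drift hs; move: yx.
move: (cabs (G s - _)) (cabs (U s N%:Z)) (cabs_ge0 (U s N%:Z)) => x y y0 yx xd Qs.
(* Only a lower bound on |u_N| is needed; it comes from expanding (y - e b)^2 >= 0. *)
have lower : (e * b) ^+ 2 - 2 * (e * b) * (drift s * e ^+ 3) <= y ^+ 2.
  have : 2 * (e * b) * (e * b - y) <= 2 * (e * b) * (drift s * e ^+ 3).
    apply: (ler_wpM2l (mulr_ge0 (ler0n _ 2%N) eb)).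
    by rewrite lerBlDl; apply: le_trans yx _; rewrite lerD2l.
  by have := sqr_ge0 (y - e * b); nra.
have J2 : 0 <= J ^+ 2 by exact: sqr_ge0.
have {}lower := ler_wpM2l J2 lower.
have qE : e ^+ 2 * q = e ^+ 2 + J ^+ 2 * (e * b) ^+ 2 by rewrite /q; ring.
apply: (@le_trans _ _ (e ^+ 2 * q + 270 * (e ^+ 2 * q) ^+ 2 - e ^+ 2
    - J ^+ 2 * ((e * b) ^+ 2 - 2 * (e * b) * (drift s * e ^+ 3)))).
  by apply: lerB lower; rewrite lerD2r.
by rewrite {1}qE le_eqVlt; apply/orP; left; apply/eqP; ring.
Qed.

(** Replacing the solution by its two modes costs Z^2 times the remainder, e^2 e^2 in all; the
    higher terms are O(e^5). *)
Let cubic_main s : 0 <= s < T ->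
  cabs (nonlin2 (U s) (con (U s)) N%:Z - (n ^+ 2 * (8 * e ^+ 2 + 12 * cabs (G s) ^+ 2))%:C * U s N%:Z)
    <= (90 * (n + 1) * z ^+ 2 * width s + 1620 * z ^+ 5) * e ^+ 4.
Proof.
move=> hs; have [s0 sT] := andP hs; have [h _] := h1_bounds hs.
have u0 : U s 0 = e%:C.
  by rewrite (mode0_const sol) ?initial_modes.1//; have [] := inT sT (_ : 0 <= s <= s); rewrite ?s0 ?lexx.
have hp := h1_two_modes_le NZ0 h.
have c1 := cubic2_diff N%:Z h hp (remainder_h1 hs).
have c2 := higher2_le Z1 h N%:Z.
have c3 := cubic2_two_modes (U s 0) (U s N%:Z) N0.
move: c1; rewrite -[kst _ + _]/(two_modes N%:Z (U s 0) (U s N%:Z)) in c3 *.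
rewrite c3 u0 cabsR real_normK ?num_real// -/n G_abs -[N%:Z%:~R]/n ger0_norm// => c1.
rewrite /nonlin2 smvalD addrAC; apply: le_trans (cabsD _ _) _.
apply: le_trans (lerD c1 c2) _.
rewrite [leRHS]mulrDl lerD//.
  by rewrite le_eqVlt; apply/orP; left; apply/eqP; rewrite /Z; ring.
rewrite /Z exprMn [e ^+ 5 * _]mulrC mulrA.
by apply: (ler_wpM2l (mulr_ge0 (ler0n _ 1620%N) (exprn_ge0 5 z0))); rewrite ler_wiXn2l// ltW.
Qed.

Lemma mode_asymptotics t : 0 <= t < T ->
  cabs (G t - (e * b)%:C - 'i%C * (n ^+ 3 * ((4 + 6 * b ^+ 2) * b) * e ^+ 3 * t)%:C)
    <= 2 * slope t * e ^+ 4 * t.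
Proof.
move=> /andP[t0 tT]; set kap := n ^+ 3 * _ * e ^+ 3.
(* The rotated mode minus its predicted linear growth; its derivative is shown to be at most slope
   e^4. *)
pose H (s : R) := G s - s%:C * ('i%C * kap%:C).
have -> : G t - (e * b)%:C - 'i%C * (kap * t)%:C = H t - H 0.
  by rewrite /H mul0r subr0 G0 RCM; ring.
have -> : 2 * slope t * e ^+ 4 * t = 2 * (slope t * e ^+ 4) * `|t - 0|.
  by rewrite subr0 ger0_norm//; ring.
apply: (@cderiv_mvt _ H (fun x => cis (n ^+ 4 * x) * ('i%C * (n / 2)%:C * nonlin2 (U x) (con (U x)) N%:Z)
   - (1 * ('i%C * kap%:C) + x%:C * 0))) => s /(minmax t0) hst; have [hs hs'] := inT tT hst.
  apply: cderivB; first exact: (rotated_mode_cderiv sol N%:Z hs').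
  by apply: cderivM; [exact: cderiv_id|exact: cderiv_cst].
have [s0 st] := andP hst.
have -> : 1 * ('i%C * kap%:C) + s%:C * 0 = 'i%C * kap%:C :> C by rewrite mul1r mulr0 addr0.
pose P := (n ^+ 2 * (8 * e ^+ 2 + 12 * cabs (G s) ^+ 2))%:C : C.
(* Two errors: the nonlinearity against the resonant term, and the resonant term against its value
   at the initial amplitude e b. *)
rewrite (_ : _ - _ = 'i%C * (cis (n ^+ 4 * s) * (n / 2)%:C * (nonlin2 (U s) (con (U s)) N%:Z - P * U s N%:Z)
   + (n ^+ 3)%:C * ((4 * e ^+ 2 + 6 * cabs (G s) ^+ 2)%:C * G s - ((4 * e ^+ 2 + 6 * (e * b) ^+ 2) * (e * b))%:C))); last first.
  have -> : kap = n ^+ 3 * ((4 * e ^+ 2 + 6 * (e * b) ^+ 2) * (e * b)) by rewrite /kap; ring.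
  have -> : P = 2%:R * n%:C ^+ 2 * (4 * e ^+ 2 + 6 * cabs (G s) ^+ 2)%:C.
    by rewrite -RC_nat -RCX -!RCM /P; congr (_%:C); ring.
  rewrite (RCM (n ^+ 3)) (RCX n) (RCM n) /G.
  have -> : (2%:R^-1)%:C = 2%:R^-1 :> C.
    by apply: (mulfI (_ : 2%:R != 0 :> C)); rewrite ?pnatr_eq0// mulfV ?pnatr_eq0// -RC_nat -RCM mulfV ?pnatr_eq0.
  have n2 : (2%:R : C) != 0 by rewrite pnatr_eq0.
  set x1 := (_ + _)%:C; set x2 := nonlin2 _ _ _; set x3 := U s _; set x4 := cis _; set x5 := n%:C.
  by field.
rewrite cabsM cabsi mul1r; apply: le_trans (cabsD _ _) _.
rewrite (cabsM (cis _ * _)) (cabsM (cis _) _%:C) (cabsM (n ^+ 3)%:C) cabs_cis mul1r !cabsR.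
rewrite ger0_norm ?divr_ge0// (ger0_norm (exprn_ge0 3 n0)).
have m1 := cubic_main hs; have m2 := mode_drift hs.
have Gz := h1_sup_Z hs.
have eb0 : 0 <= e * b by rewrite mulr_ge0// ltW.
have ebZ : e * b <= Z.
  have := h1_sup_Z (_ : 0 <= 0 < T); rewrite G0 cabsR ger0_norm//; apply.
  by rewrite lexx /=; lra.
have m3 := cube_diff e eb0 ebZ Gz m2.
have ds := drift_mono st; have d0 := drift_ge0 s0.
have ws : width s <= width t.
  rewrite /width ler_wsqrtr// lerD2l; apply: ler_wpM2l ds.
  exact: mulr_ge0 (mulr_ge0 (ler0n _ 2%N) (sqr_ge0 J)) (ltW b0).
rewrite /slope [leRHS]mulrDl; apply: lerD.
  rewrite -[leRHS]mulrA ler_wpM2l ?divr_ge0//; apply: le_trans m1 _.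
  apply: (ler_wpM2r (exprn_ge0 4 (ltW e0))); rewrite lerD2r; apply: ler_wpM2l ws.
  exact: mulr_ge0 (mulr_ge0 (ler0n _ 90%N) (addr_ge0 n0 ler01)) (sqr_ge0 z).
rewrite [leRHS](_ : _ = n ^+ 3 * ((4 + 18 * z ^+ 2) * (drift t * e ^+ 4))); last by ring.
rewrite ler_wpM2l ?exprn_ge0//. apply: le_trans m3 _.
have -> : (4 * e ^+ 2 + 18 * Z ^+ 2) * (drift s * e ^+ 3) = (4 + 18 * z ^+ 2) * (drift s * e ^+ 5).
  by rewrite /Z; ring.
apply: (ler_wpM2l (addr_ge0 (ler0n _ 4%N) (mulr_ge0 (ler0n _ 18%N) (sqr_ge0 z)))).
apply: ler_pM d0 (exprn_ge0 5 (ltW e0)) ds _.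
by rewrite ler_wiXn2l// ltW.
Qed.

End Asymptotics.

(** * Third derivatives in the Fourier-Lebesgue norm *)

Section FourierLebesgueNorm.
Variable R : realType.
Local Notation C := R[i].
Implicit Types (s B c : R) (r : \bar R) (a : seqC R) (k : int).

Lemma conjugate_exponent (r0 : R) : 1 < r0 ->
  0 < r0 / (r0 - 1) /\ (r0 / (r0 - 1))^-1 <= 1.
Proof.
move=> r1; have h : 0 < r0 - 1 by rewrite subr_gt0.
have r0p : 0 < r0 by exact: lt_trans ltr01 r1.
split; first by rewrite divr_gt0.
by rewrite invf_div ler_pdivrMr// mul1r lerBlDr lerDl.
Qed.

(** This transfers norm estimates to a single Fourier coefficient, for all exponents at once. *)
Lemma FLnorm_coef s r a k : (1 <= r)%E ->
  ((jbr R k `^ s * cabs (a k))%:E <= FLnorm s r a)%E.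
Proof.
have w0 j : 0 <= jbr R j `^ s * cabs (a j) by rewrite mulr_ge0 ?powR_ge0 ?cabs_ge0.
have term (f : int -> R) : (forall j, 0 <= f j) ->
    ((f k)%:E <= \esum_(j in [set: int]) (f j)%:E)%E.
  move=> f0; apply: esum_ge; exists [set k]%classic; last by rewrite fsbig_set1.
  by split => //; exact: finite_set1.
case: r => [r0| |] //= r1; last by apply: term.
case: eqP => [_|/eqP r01]; first by apply: ereal_sup_ubound; exists k.
have {}r1 : 1 < r0 by rewrite lt_neqAle eq_sym r01 -lee_fin.
have [p0 _] := conjugate_exponent r1; set p := r0 / _ in p0 *.
rewrite -[leLHS](_ : poweR ((jbr R k `^ s * cabs (a k)) `^ p)%:E p^-1 = _); last first.
  by rewrite poweR_EFin -powRrM mulfV ?gt_eqF// powRr1.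
apply: gt0_ler_poweR; rewrite ?invr_ge0 ?(ltW p0)// ?in_itv /= ?leey ?andbT ?lee_fin ?powR_ge0//.
- by apply: esum_ge0 => j _; rewrite lee_fin powR_ge0.
- by apply: (term (fun j => (jbr R j `^ s * cabs (a j)) `^ p)) => j; exact: powR_ge0.
Qed.

(** The l^p norm of two entries of size c is at most 2^(1/p) c, and 1/p <= 1; hence one constant for
    all r. *)
Lemma FLnorm_two_modes s r a k c : (1 <= r)%E -> 0 <= c ->
  (forall j, j != 0 -> j != k -> a j = 0) ->
  (forall j, jbr R j `^ s * cabs (a j) <= c) ->
  (FLnorm s r a <= (2 * c)%:E)%E.
Proof.
move=> r1 c0 supp wc.
have w0 j : 0 <= jbr R j `^ s * cabs (a j) by rewrite mulr_ge0 ?powR_ge0 ?cabs_ge0.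
have delta m B : 0 <= B -> (\esum_(j in [set: int]) (if j \in [set m]%classic then B%:E else 0) = B%:E)%E.
  by move=> B0; rewrite -(esum_mkcond [set m]%classic (fun=> B%:E)) esum_set1.
have sum2 (f : int -> R) B : (forall j, 0 <= f j <= B) -> (forall j, j != 0 -> j != k -> f j = 0) ->
    (\esum_(j in [set: int]) (f j)%:E <= (2 * B)%:E)%E.
  move=> fB f0; have B0 : 0 <= B by have /andP[] := fB 0; exact: le_trans.
  have d0 m j : (0 <= if j \in [set m]%classic then B%:E else 0)%E.
    by case: ifP => _; rewrite ?lee_fin.
  rewrite (_ : (2 * B)%:E = \esum_(j in [set: int]) ((if j \in [set 0%R]%classic then B%:E else 0) + (if j \in [set k]%classic then B%:E else 0)))%E.
    apply: le_esum => j _; have /andP[fj0 fjB] := fB j.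
    have [->|j0] := eqVneq j 0.
      rewrite mem_set//; apply: (@le_trans _ _ B%:E); first by rewrite lee_fin; have /andP[] := fB 0.
      by rewrite leeDl.
    have [->|jk] := eqVneq j k.
      rewrite (mem_set (_ : [set k]%classic k))//; apply: (@le_trans _ _ B%:E); first by rewrite lee_fin; have /andP[] := fB k.
      by rewrite leeDr.
    by rewrite f0// adde_ge0.
  rewrite esumD => [|j _|j _]; [|exact: d0|exact: d0].
  by rewrite !delta// -EFinD mulr2n mulrDl mul1r.
have supp0 j : j != 0 -> j != k -> jbr R j `^ s * cabs (a j) = 0.
  by move=> j0 jk; rewrite supp// cabs0 mulr0.
case: r r1 => [r0| |] //= r1; last first.
  by apply: sum2 => // j; rewrite w0 wc.
case: eqP => [_|/eqP r01].
  apply: ge_ereal_sup => _ [j _ <-]; rewrite lee_fin; apply: le_trans (wc j) _.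
  by rewrite ler_peMl// ler1n.
have {}r1 : 1 < r0 by rewrite lt_neqAle eq_sym r01 -lee_fin.
have [p0 p1] := conjugate_exponent r1; set p := r0 / _ in p0 p1 *.
have cp : 0 <= c `^ p by exact: powR_ge0.
apply: (@le_trans _ _ (poweR (2 * c `^ p)%:E p^-1)).
  apply: gt0_ler_poweR; rewrite ?invr_ge0 ?(ltW p0)// ?in_itv /= ?leey ?andbT ?lee_fin ?mulr_ge0//.
  - by apply: esum_ge0 => j _; rewrite lee_fin powR_ge0.
  - apply: sum2 => [j|j j0 jk]; last by rewrite supp0// powR0// gt_eqF.
    by rewrite powR_ge0/= ge0_ler_powR ?nnegrE ?(ltW p0).
rewrite poweR_EFin lee_fin powRM// -powRrM mulfV ?gt_eqF// powRr1// ler_wpM2r//.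
by rewrite ler1_powR// ler1n.
Qed.

End FourierLebesgueNorm.

(** * Third-order Taylor expansion of complex-valued functions of a real variable *)

Section TaylorExpansion.
Variable R : realType.
Local Notation C := R[i].

Lemma cderiv_approx (g : R -> C) x (d : C) :
  (forall e : R, 0 < e -> exists del : R, 0 < del /\
     forall h, `|h| < del -> cabs (g (x + h) - g x - h%:C * d) <= e * `|h|) ->
  cderiv g x d.
Proof.
move=> H.
have comp (f : C -> R) : (forall z w, f (z - w) = f z - f w) -> (forall z, `|f z| <= cabs z) ->
    (forall (h : R) z, f (h%:C * z) = h * f z) -> is_derive x 1 (fun y => f (g y)) (f d).
  move=> fB fle fZ; apply/is_derive1_caratheodory.
  exists (fun y => if y == x then f d else (f (g y) - f (g x)) / (y - x)); split.
  - move=> y; case: eqP => [->|/eqP yx]; first by rewrite !subrr mulr0.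
    by rewrite divfK// subr_eq0.
  - apply/cvgrPdist_le => e e0; have [del [del0 hdel]] := H e e0.
    apply/nbhs_ballP; exists del => // y /=; rewrite /ball /= => xy.
    rewrite eqxx; case: eqP => [_|/eqP yx]; first by rewrite subrr normr0 ltW.
    have yx0 : 0 < `|y - x| by rewrite normr_gt0 subr_eq0.
    have := hdel (y - x); rewrite distrC => /(_ xy); rewrite distrC addrCA subrr addr0 => hy.
    have := le_trans (fle _) hy; rewrite !fB fZ => hf.
    rewrite distrC -(ler_pM2r yx0) -normrM mulrBl divfK ?subr_eq0//.
    by rewrite [f d * _]mulrC.
  - by rewrite eqxx.
split.
- apply: (comp (@complex.Re R)) => [z w|z|h z]; [by rewrite ReD ReN|exact: Re_cabs|].
  by rewrite cReM /= mul0r subr0.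
- apply: (comp (@complex.Im R)) => [z w|z|h z]; [by rewrite ImD ImN|exact: Im_cabs|].
  by rewrite cImM /= mul0r addr0.
Qed.

Lemma cderiv_poly (a0 a1 a2 a3 : C) (x : R) :
  cderiv (fun y : R => a0 + y%:C * (a1 + y%:C * (a2 + y%:C * a3))) x
    (a1 + x%:C * (2%:R * a2 + x%:C * (3%:R * a3))).
Proof.
have add f g D E : cderiv f x D -> cderiv g x E -> cderiv (fun y => f y + g y) x (D + E).
  move=> hf hg; have := cderivB hf (cderivB (cderiv_cst 0 x) hg).
  rewrite sub0r opprK; apply: cderiv_ext => y; ring.
have lin a f D : cderiv f x D -> cderiv (fun y => a + y%:C * f y) x (f x + x%:C * D).
  move=> hf; have := add _ _ _ _ (cderiv_cst a x) (cderivM (cderiv_id x) hf).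
  by rewrite add0r mul1r.
have := lin a0 _ _ (lin a1 _ _ (lin a2 _ _ (cderiv_cst a3 x))).
congr cderiv; ring.
Qed.

(** Peano's form of the remainder: [g2] is only differentiable at 0, and its first-order expansion
    is integrated twice by the mean value inequality. *)
Lemma taylor3 (g g1 g2 : R -> C) (d3 : C) :
  (forall x, cderiv g x (g1 x)) -> (forall x, cderiv g1 x (g2 x)) ->
  (forall e : R, 0 < e -> exists del : R, 0 < del /\
     forall h, `|h| < del -> cabs (g2 h - g2 0 - h%:C * d3) <= e * `|h|) ->
  forall e : R, 0 < e -> exists del : R, 0 < del /\ forall h, 0 <= h < del ->
    cabs (g h - (g 0 + h%:C * (g1 0 + h%:C * (g2 0 / 2%:R + h%:C * (d3 / 6%:R))))) <= e * h ^+ 3.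
Proof.
move=> hg hg1 hg2 e e0.
(* Each of the two applications of [cderiv_mvt] doubles the constant. *)
have e4 : 0 < e / 4 by rewrite divr_gt0.
have [del [del0 H]] := hg2 _ e4; exists del; split=> // h /andP[h0 hd].
have mm (x y : R) : 0 <= y -> Num.min 0 y <= x <= Num.max 0 y -> 0 <= x <= y.
  by move=> y0; rewrite (min_idPl y0) (max_idPr y0).
have n2 : (2%:R : C) != 0 by rewrite pnatr_eq0.
have n6 : (6%:R : C) != 0 by rewrite pnatr_eq0.
pose r1 (x : R) := g1 x - (g1 0 + x%:C * (g2 0 + x%:C * (d3 / 2%:R + x%:C * 0))).
pose r0 (x : R) := g x - (g 0 + x%:C * (g1 0 + x%:C * (g2 0 / 2%:R + x%:C * (d3 / 6%:R)))).
have b1 x : 0 <= x <= h -> cabs (r1 x) <= e / 2 * h * h.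
  move=> /andP[x0 xh].
  have -> : r1 x = r1 x - r1 0 by rewrite /r1 mul0r addr0 !subrr subr0.
  apply: (@le_trans _ _ (2 * (e / 4 * h) * `|x - 0|)).
    apply: (@cderiv_mvt _ r1 (fun y => g2 y - (g2 0 + y%:C * (2%:R * (d3 / 2%:R) + y%:C * (3%:R * 0))))) => y /(mm _ _ x0) /andP[y0 yx].
      exact: cderivB (hg1 y) (cderiv_poly _ _ _ _ y).
    rewrite (_ : _ - _ = g2 y - g2 0 - y%:C * d3); last by field.
    apply: le_trans (H y _) _; first by rewrite ger0_norm//; lra.
    by rewrite ger0_norm// ler_wpM2l; lra.
  rewrite subr0 ger0_norm// (_ : 2 * (e / 4 * h) = e / 2 * h); last by field.
  by rewrite ler_wpM2l// mulr_ge0//; lra.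
rewrite -/(r0 h) (_ : r0 h = r0 h - r0 0); last by rewrite /r0 mul0r addr0 !subrr subr0.
apply: (@le_trans _ _ (2 * (e / 2 * h * h) * `|h - 0|)).
  apply: (@cderiv_mvt _ r0 (fun y => g1 y - (g1 0 + y%:C * (2%:R * (g2 0 / 2%:R) + y%:C * (3%:R * (d3 / 6%:R)))))) => y /(mm _ _ h0) yh.
    exact: cderivB (hg y) (cderiv_poly _ _ _ _ y).
  apply: le_trans (b1 y yh); rewrite le_eqVlt; apply/orP; left; apply/eqP; congr cabs.
  rewrite /r1; by field.
rewrite subr0 ger0_norm// le_eqVlt; apply/orP; left; apply/eqP; by field.
Qed.

Lemma cubic_little_o (c0 c1 c2 c3 : C) :
  (forall e : R, 0 < e -> exists del : R, 0 < del /\ forall h, 0 < h < del ->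
    cabs (c0 + h%:C * (c1 + h%:C * (c2 + h%:C * c3))) <= e * h ^+ 3) -> c3 = 0.
Proof.
move=> H; apply: cabs_eq0; apply/eqP; rewrite eq_le cabs_ge0 andbT.
apply/ler_addgt0Pr => e e0; rewrite add0r.
(* The third difference is 6 h^3 c3 and its four values contribute 64 + 1 + 3 (27 + 8) = 170 <= 6
   times 30. Taking h = del / 5 keeps 4h below del. *)
have e30 : 0 < e / 30 by rewrite divr_gt0.
have [del [del0 hd]] := H _ e30.
pose h := del / 5; have h0 : 0 < h by rewrite divr_gt0.
pose p (x : R) := c0 + x%:C * (c1 + x%:C * (c2 + x%:C * c3)).
have bound (m : nat) : (0 < m < 5)%N -> cabs (p (m%:R * h)) <= e / 30 * (m%:R ^+ 3 * h ^+ 3).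
  move=> /andP[m0 m5]; rewrite -exprMn; apply: hd.
  rewrite mulr_gt0 ?ltr0n//= /h mulrCA gtr_pMr// ltr_pdivrMr// mul1r.
  by rewrite (ltr_nat _ m 5).
(* the third finite difference annihilates quadratic polynomials *)
have -> : cabs c3 = cabs (p (4%:R * h) - p (1%:R * h) - 3%:R * (p (3%:R * h) - p (2%:R * h))) / (6 * h ^+ 3).
  rewrite (_ : _ - _ = (6 * h ^+ 3)%:C * c3); last first.
    rewrite /p !(RCM _ h) !RC_nat (RCM 6) (RCX h) -[6]/(6%:R : R) RC_nat; ring.
  rewrite cabsM cabsR ger0_norm; last by rewrite mulr_ge0// exprn_ge0// ltW.
  by rewrite mulrC mulKf// mulf_neq0// gt_eqF// exprn_gt0.
rewrite ler_pdivrMr; last by rewrite mulr_gt0// exprn_gt0.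
have k3 : cabs (3%:R : C) = 3 by rewrite -RC_nat cabsR ger0_norm.
have := bound 1%N isT; have := bound 2%N isT; have := bound 3%N isT; have := bound 4%N isT.
set x1 := p (1%:R * h); set x2 := p (2%:R * h); set x3 := p (3%:R * h); set x4 := p (4%:R * h).
move=> B4 B3 B2 B1; apply: le_trans (cabsB _ _) _; rewrite cabsM k3.
have := cabsB x4 x1; have := cabsB x3 x2.
have h3 : 0 <= h ^+ 3 by rewrite exprn_ge0// ltW.
move: (h ^+ 3) h3 B4 B3 B2 B1 => w w0 B4 B3 B2 B1 D1 D2.
have ew : 0 <= e * w by rewrite mulr_ge0// ltW.
rewrite (_ : 4%:R ^+ 3 = 64) in B4; last by ring.
rewrite (_ : 3%:R ^+ 3 = 27) in B3; last by ring.
rewrite (_ : 2%:R ^+ 3 = 8) in B2; last by ring.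
rewrite (_ : 1%:R ^+ 3 = 1) in B1; last by ring.
lra.
Qed.

End TaylorExpansion.

(** * Restriction of a C^3 map to a line and to one Fourier coefficient *)

Section ThirdDerivative.
Variable R : realType.
Local Notation C := R[i].
Variables (s : R) (r : \bar R).
Hypothesis r1 : (1 <= r)%E.
Implicit Types (a b phi : seqC R) (k : int).

Lemma FLn_le a c : (FLnorm s r a <= c%:E)%E -> 0 <= FLn s r a <= c.
Proof.
have := FLnorm_coef s a 0 r1; rewrite /FLn; case: (FLnorm s r a) => [x| |] //=.
rewrite !lee_fin => h ->; rewrite andbT; apply: le_trans h.
by rewrite mulr_ge0 ?powR_ge0 ?cabs_ge0.
Qed.

Lemma rlinear_scale (L : seqC R -> seqC R) c b : rlinear s r L ->
  FL s r (fun=> 0) -> FL s r b -> L (scaleS c b) = scaleS c (L b).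
Proof.
move=> lin X0 Xb.
have e0 d x : addS (fun=> 0 : C) (scaleS d x) = scaleS d x.
  by apply/funext => k; rewrite /addS add0r.
have L0 k : L (fun=> 0) k = 0.
  have := lin _ _ X0 X0 1; rewrite e0 (_ : scaleS 1 _ = (fun=> 0)); last first.
    by apply/funext => j; rewrite /scaleS mulr0.
  move=> /(congr1 (fun a => a k)); rewrite /addS /scaleS mul1r => h.
  by apply: (addrI (L (fun=> 0) k)); rewrite addr0 -h.
by rewrite -e0 (lin _ _ X0 Xb); apply/funext => k; rewrite /addS L0 add0r.
Qed.

Lemma approx_coef (w K : R) (P : R -> C) : 0 < w -> 0 < K ->
  (forall eps : R, 0 < eps -> exists del : R, 0 < del /\
     forall h, 2 * `|h| < del -> w * cabs (P h) <= eps * (K * `|h|)) ->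
  forall e : R, 0 < e -> exists del : R, 0 < del /\
     forall h, `|h| < del -> cabs (P h) <= e * `|h|.
Proof.
move=> w0 K0 H e e0.
have [|del [del0 hd]] := H (e * w / K); first by rewrite divr_gt0 ?mulr_gt0.
exists (del / 2); split=> [|h hh]; first by rewrite divr_gt0.
rewrite -(ler_pM2l w0); apply: le_trans (hd h _) _; first by move: hh; rewrite ltr_pdivlMr// mulrC.
by rewrite mulrA divfK ?gt_eqF// mulrA [w * e]mulrC.
Qed.

(** [M] bounds the third derivative at the origin and is chosen before [phi] and [k]; this
    uniformity is what the growth in N contradicts. The 8 is 2^3, as [phi] has norm at most 2. *)
Lemma C3_third_derivative (F : seqC R -> seqC R) : C3_on s r F ->
  exists2 M : R, 0 <= M & forall phi k,
    (forall x : R, (FLnorm s r (scaleS x phi) <= (2 * `|x|)%:E)%E) ->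
    exists g1 g2 : R -> C, exists d3 : C,
    [/\ forall x, cderiv (fun y => F (scaleS y phi) k) x (g1 x),
        forall x, cderiv g1 x (g2 x),
        forall e : R, 0 < e -> exists del : R, 0 < del /\
          forall h, `|h| < del -> cabs (g2 h - g2 0 - h%:C * d3) <= e * `|h| &
        jbr R k `^ s * cabs d3 <= 8 * M].
Proof.
move=> [_ [D1 [D2 [D3 HD]]]].
have zeroE phi : scaleS 0 phi = (fun=> 0).
  by apply/funext => k; rewrite /scaleS mul0r.
have X0 : FL s r (fun=> 0).
  have := @FLnorm_two_modes R s r (fun=> 0) 0 0 r1 (lexx 0) (fun _ _ _ => erefl).
  move=> h; rewrite /FL /=; apply: le_lt_trans (h _) (ltry _) => j.
  by rewrite cabs0 mulr0.
have [[_ _ [_ [_ [_ [M HM]]]]] _ _ _ _] := HD _ X0.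
exists `|M| => // phi k small.
have w0 : 0 < jbr R k `^ s by rewrite powR_gt0// jbr_gt0.
have Xs x : FL s r (scaleS x phi) by rewrite /FL /=; exact: le_lt_trans (small x) (ltry _).
have Ns x := FLn_le (small x).
have phi1 : scaleS 1 phi = phi by apply/funext => j; rewrite /scaleS mul1r.
have Xp : FL s r phi by rewrite -phi1.
have Np : 0 <= FLn s r phi <= 2 by have := Ns 1; rewrite phi1 normr1 mulr1.
have addE x h : addS (scaleS x phi) (scaleS h phi) = scaleS (x + h) phi.
  by apply/funext => j; rewrite /addS /scaleS RCD mulrDl.
pose g1 (x : R) := D1 (scaleS x phi) phi k.
pose g2 (x : R) := D2 (scaleS x phi) phi phi k.
pose d3 (x : R) := D3 (scaleS x phi) phi phi phi k.
exists g1, g2, (d3 0).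
have coefE a b c (B : R) : (FLnorm s r (subS (subS a b) c) <= B%:E)%E ->
    jbr R k `^ s * cabs (a k - b k - c k) <= B.
  by move=> h; rewrite -lee_fin; apply: le_trans h; exact: (FLnorm_coef s (subS (subS a b) c) k r1).
have approx3 (x e : R) : 0 < e -> exists del : R, 0 < del /\
    (* The increment is h phi: linearity in the increment slot extracts h, and the norms of the
       increment and of the two fixed arguments give 2|h| times 2 times 2. *)
    forall h, `|h| < del -> cabs (g2 (x + h) - g2 x - h%:C * d3 x) <= e * `|h|.
  have [[_ _ [lin _]] _ _ c3 _] := HD _ (Xs x).
  move: e; apply: (approx_coef w0 (_ : 0 < 8)) => // eps eps0.
  have [del [del0 hd]] := c3 _ eps0; exists del; split=> // h hh.
  have /andP[n0 n1] := Ns h; have /andP[p0 p1] := Np.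
  have := hd _ (Xs h) (le_lt_trans n1 hh) _ _ Xp Xp.
  rewrite addE (rlinear_scale _ (lin _ _ Xp Xp) X0 Xp) => /coefE /le_trans; apply.
  rewrite -!mulrA ler_wpM2l ?(ltW eps0)//.
  apply: (@le_trans _ _ (2 * `|h| * (2 * 2))); last by rewrite le_eqVlt; apply/orP; left; apply/eqP; ring.
  by apply: ler_pM => //; [exact: mulr_ge0|exact: ler_pM].
split; last first.
- have := HM _ _ _ Xp Xp Xp; rewrite -(zeroE phi) => h.
  have := FLnorm_coef s (D3 (scaleS 0 phi) phi phi phi) k r1.
  move=> /le_trans /(_ h); rewrite lee_fin => /le_trans; apply.
  have /andP[p0 p1] := Np.
  rewrite -!mulrA; apply: le_trans (ler_wpM2r _ (ler_norm M)) _; first by rewrite !mulr_ge0.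
  rewrite [leRHS]mulrC ler_wpM2l//.
  apply: (@le_trans _ _ (2 * (2 * 2))); last by lra.
  by apply: ler_pM => //; [exact: mulr_ge0|exact: ler_pM].
- by move=> e /(approx3 0 e) [del [del0 hd]]; exists del; split=> // h /hd; rewrite add0r.
- move=> x; apply: cderiv_approx.
  have [[_ [lin _] _] _ c2 _ _] := HD _ (Xs x).
  apply: (approx_coef w0 (_ : 0 < 4)) => // eps eps0.
  have [del [del0 hd]] := c2 _ eps0; exists del; split=> // h hh.
  have /andP[n0 n1] := Ns h; have /andP[p0 p1] := Np.
  have := hd _ (Xs h) (le_lt_trans n1 hh) _ Xp.
  rewrite addE (rlinear_scale _ (lin _ Xp) X0 Xp) => /coefE /le_trans; apply.
  rewrite -!mulrA ler_wpM2l ?(ltW eps0)//.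
  apply: (@le_trans _ _ (2 * `|h| * 2)); last by rewrite le_eqVlt; apply/orP; left; apply/eqP; ring.
  exact: ler_pM.
- move=> x; apply: cderiv_approx.
  have [[[lin _] _ _] c1 _ _ _] := HD _ (Xs x).
  apply: (approx_coef w0 (_ : 0 < 2)) => // eps eps0.
  have [del [del0 hd]] := c1 _ eps0; exists del; split=> // h hh.
  have /andP[n0 n1] := Ns h.
  have := hd _ (Xs h) (le_lt_trans n1 hh).
  rewrite addE (rlinear_scale _ lin X0 Xp) => /coefE /le_trans; apply.
  by rewrite ler_wpM2l ?(ltW eps0).
Qed.

End ThirdDerivative.

(** * Comparison of the two expansions and conclusion *)

Lemma scale_two_modes (R : realType) (k : int) (al be : R[i]) (h : R) :
  scaleS h (two_modes k al be) = two_modes k (h%:C * al) (h%:C * be).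
Proof.
apply/funext => j; rewrite /scaleS -kst_mulE; apply: (congr1 (fun x : smooth R => x j)).
by rewrite /two_modes !kstM mulrDr mulrA.
Qed.

(** The linear phase e^{-i N^4 t} becomes the unimodular [c], independent of the amplitude h. *)
Lemma flow_mode_expansion (R : realType) (T t b : R) (S : seqC R -> R -> seqC R) (N : nat) :
  flow_map T S -> 0 < t < T -> (0 < N)%N -> 0 < b ->
  let kap := N%:R ^+ 3 * ((4 + 6 * b ^+ 2) * b) * t in
  exists c : R[i], cabs c = 1 /\ exists K : R, 0 <= K /\ exists del : R, 0 < del /\
    forall h : R, 0 < h < del ->
      cabs (S (scaleS h (two_modes N%:Z 1 b%:C)) t N%:Z
        - h%:C * (c * b%:C) - (h ^+ 3)%:C * (c * 'i%C * kap%:C)) <= K * h ^+ 4.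
Proof.
move=> flow /andP[t0 tT] N0 b0 kap.
pose q : R := 1 + (jbr R N%:Z * b) ^+ 2.
have q0 : 0 < 300 * q.
  by apply: mulr_gt0 (ltr_wpDr (sqr_ge0 _) ltr01); rewrite ltr0n.
set d := cis (N%:R ^+ 4 * t); have d1 : cabs d = 1 by exact: cabs_cis.
exists (conjc d); split; first by rewrite cabsJ.
exists `|2 * slope N b t * t|; split=> //.
exists (Num.min 1 (300 * q)^-1); split; first by rewrite lt_min ltr01 invr_gt0.
move=> h /andP[h0]; rewrite lt_min => /andP[h1 hq].
set phi := scaleS _ _.
have phiE : phi = two_modes N%:Z h%:C (h * b)%:C.
  by rewrite /phi scale_two_modes mulr1 RCM.
have sphi : smooth_data phi by rewrite phiE; exact: smoothP.
have [sol S0] := flow phi sphi.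
have init : curve (S phi) 0 = two_modes N%:Z h%:C (h * b)%:C.
  apply: smooth_inj => k; rewrite (curveE sol) ?S0 ?phiE//; lra.
(* As h <= 1, h^2 <= h, so the threshold [(300 * q)^-1] on h suffices. *)
have small : 300 * (h ^+ 2 * q) <= 1.
  rewrite mulrCA; apply: (@le_trans _ _ (h * (300 * q))).
    rewrite ler_wpM2r ?(ltW q0)// expr2 ler_piMl//; exact: ltW.
  by rewrite -ler_pdivlMr// mul1r ltW.
have tt : 0 <= t < T by rewrite (ltW t0) tT.
have := mode_asymptotics sol N0 b0 h0 (ltW h1) init small tt.
rewrite (curveE sol); last by apply/andP; split; lra.
set g := S phi t N%:Z => H.
have dd : conjc d * d = 1 by rewrite mulrC mulcJ d1 expr1n.
rewrite (_ : g - _ - _ = conjc d * (d * g - (h * b)%:C - 'i%C * (kap * h ^+ 3)%:C)); last first.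
  rewrite (_ : conjc d * (_ - _) = conjc d * d * g - conjc d * (h * b)%:C - conjc d * ('i%C * (kap * h ^+ 3)%:C)).
    rewrite dd mul1r (RCM h) (RCM kap).
    by move: (h ^+ 3)%:C kap%:C (conjc d) (g) => x y z a; ring.
  by rewrite !mulrBr (mulrA _ d g).
rewrite cabsM cabsJ d1 mul1r.
have kE : kap * h ^+ 3 = N%:R ^+ 3 * ((4 + 6 * b ^+ 2) * b) * h ^+ 3 * t by rewrite /kap mulrAC.
rewrite kE; apply: le_trans H _.
rewrite -mulrA [h ^+ 4 * t]mulrC mulrA ler_wpM2r ?exprn_ge0 ?(ltW h0)//; exact: ler_norm.
Qed.

Theorem theorem3p7 (R : realType) (r : \bar R) (s T : R) :
  (1 <= r)%E -> 0 < T ->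
  ~ exists S : seqC R -> R -> seqC R,
      flow_map T S /\
      forall t, -T < t < T -> C3_on s r (fun u0 => S u0 t).
Proof.
move=> r1 T0 [S [flow C3]].
pose t := T / 2; have t0 : 0 < t by rewrite divr_gt0.
have tT : t < T by rewrite ltr_pdivrMr// ltr_pMr// (ltr_nat _ 1 2).
have tin : - T < t < T by apply/andP; split => //; lra.
have [M M0 HM] := C3_third_derivative r1 (C3 t tin).
(* The final comparison reads 24 N t <= 8 M; N is taken large enough to violate it. *)
pose N := (Num.bound (M / (3 * t))).+1.
have t3 : 0 < 3 * t by rewrite mulr_gt0.
have NM : M < N%:R * (3 * t).
  rewrite -ltr_pdivrMr//; apply: lt_trans (archi_boundP _) _; first by rewrite divr_ge0// ltW.
  by rewrite ltr_nat.
pose w := jbr R N%:Z `^ s; have w0 : 0 < w by rewrite powR_gt0// jbr_gt0.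
(* Normalises the weighted size of mode N to 1, the weighted size of the constant mode. *)
pose b := w^-1; have b0 : 0 < b by rewrite invr_gt0.
have wb : w * b = 1 by rewrite mulfV// gt_eqF.
have NZ : N%:Z != 0 by [].
have phi_small (x : R) : (FLnorm s r (scaleS x (two_modes N%:Z 1%R b%:C)) <= (2 * `|x|)%:E)%E.
  rewrite scale_two_modes; apply: (@FLnorm_two_modes R s r _ N%:Z) => // [j j0 jN|j].
    by rewrite two_modesE// (negPf j0) (negPf jN).
  rewrite two_modesE//; case: eqP => [->|_].
    by rewrite jbr0 powR1 mul1r mulr1 cabsR.
  case: eqP => [->|_]; last by rewrite cabs0 mulr0.
  by rewrite -RCM cabsR normrM (gtr0_norm b0) mulrCA -/w wb mulr1.
have [g1 [g2 [d3 [hg hg1 hg2 d3M]]]] := HM _ N%:Z phi_small.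
have tt : 0 < t < T by rewrite t0 tT.
have [c [c1 [K [K0 [del [del0 expand]]]]]] := flow_mode_expansion flow tt (ltn0Sn _ : (0 < N)%N) b0.
set kap := _ * t in expand.
set phi := two_modes _ _ _ in hg phi_small expand.
pose g (x : R) := S (scaleS x phi) t N%:Z.
have : d3 / 6%:R - c * 'i%C * kap%:C = 0.
  (* The Taylor expansion of the assumed C^3 flow and the expansion from the dynamics describe the
     same coefficient, so their difference is a cubic polynomial that is o(h^3). *)
  apply: (@cubic_little_o R (g 0) (g1 0 - c * b%:C) (g2 0 / 2%:R)) => e e0.
  have e2 : 0 < e / 2 by rewrite divr_gt0.
  have [del1 [del10 tay]] := taylor3 hg hg1 hg2 e2.
  (* Below this threshold K h^4 <= (e/2) h^3; the 1 covers K = 0. *)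
  have eK : 0 < e / 2 / (K + 1) by rewrite divr_gt0// ltr_wpDl.
  exists (Num.min del (Num.min del1 (e / 2 / (K + 1)))); split.
    by rewrite !lt_min del0 del10 eK.
  move=> h /andP[h0]; rewrite !lt_min => /and3P[hd hd1 hK].
  have hA : 0 < h < del by rewrite h0 hd.
  have hB : 0 <= h < del1 by rewrite (ltW h0) hd1.
  have A := expand h hA; have B := tay h hB.
  rewrite -/(g h) in A; rewrite -/(g h) -/(g 0) in B.
  have C := cabsB (g h - h%:C * (c * b%:C) - (h ^+ 3)%:C * (c * 'i%C * kap%:C))
     (g h - (g 0 + h%:C * (g1 0 + h%:C * (g2 0 / 2%:R + h%:C * (d3 / 6%:R))))).
  rewrite (_ : g 0 + _ = g h - h%:C * (c * b%:C) - (h ^+ 3)%:C * (c * 'i%C * kap%:C) -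
     (g h - (g 0 + h%:C * (g1 0 + h%:C * (g2 0 / 2%:R + h%:C * (d3 / 6%:R)))))); last first.
    by rewrite RCX; ring.
  apply: le_trans C _; apply: le_trans (lerD A B) _.
  rewrite [e in leRHS](splitr e) mulrDl lerD2r exprS mulrA ler_wpM2r ?exprn_ge0 ?(ltW h0)//.
  apply: (@le_trans _ _ ((K + 1) * h)); first by rewrite ler_wpM2r ?(ltW h0)// lerDl.
  by rewrite mulrC -ler_pdivlMr ?ltr_wpDl// ltW.
move=> /eqP; rewrite subr_eq0 => /eqP d3E.
have n6 : (6%:R : R[i]) != 0 by rewrite pnatr_eq0.
have k0 : 0 <= kap.
  rewrite /kap mulr_ge0 ?(ltW t0)// mulr_ge0 ?exprn_ge0// mulr_ge0 ?(ltW b0)//.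
  by rewrite addr_ge0// mulr_ge0// sqr_ge0.
have : cabs d3 = 6 * kap.
  rewrite -[d3](divfK n6) d3E !cabsM c1 cabsi !mul1r cabsR ger0_norm// -RC_nat cabsR ger0_norm//.
  by rewrite mulrC.
move=> d3K; move: d3M; rewrite d3K -/w /kap => d3M.
(* The weight cancels against the single factor b, leaving N^3 t (24 + 36 b^2); here N <= N^3 is
   already enough. *)
have : 24 * (N%:R * t) <= 8 * M.
  apply: le_trans d3M.
  rewrite (_ : w * _ = (w * b) * (N%:R ^+ 3 * t * (24 + 36 * b ^+ 2))); last by ring.
  rewrite wb mul1r [leLHS]mulrC; apply: ler_pM => //.
  - by rewrite mulr_ge0// ltW.
  - by rewrite ler_wpM2r ?(ltW t0)// -[leLHS]expr1 ler_weXn2l// ler1n.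
  - by rewrite lerDl mulr_ge0// sqr_ge0.
move: NM; rewrite mulrCA; move: (N%:R * t) => x; lra.
Qed.
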